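(* Let $\beta\in(0,1)\cup(1,2)$, and let $\mathcal F$, $\mathcal S$, $L$, $\mathcal H$, $\mathcal I$, $\sigma_\pm$, $\mu$, $\varphi^*$, $a_1,b_1,a_2,b_2$, $\theta^*$, $L_\theta$ be as described in the context. For each $\theta$ let $\varphi=\varphi_\theta(r)$ be the equation, in the polar coordinates $z=re^{i\varphi}$ near $z=0$, of the curve $L_\theta$. Then the following holds. (I) If $\beta\in(0,1)$, then for every $\theta\in(0,\pi)$ $$\varphi_\theta(r)=\varphi^*+E_1\,r^{1/\beta-1}+o\bigl(r^{1/\beta-1}\bigr),\quad r\to0,\qquad E_1=\mu^{-1}(a_1-b_1\cot\theta)\cos\frac{\varphi^*}{\beta},$$ while for $\theta=0$ and $\theta=\pi$ one has exactly $\varphi_0(r)=-\frac{\pi\beta}{2}$ and $\varphi_\pi(r)=\frac{\pi\beta}{2}$. (II) If $\beta\in(1,2)$, then, as $r\to0$, $$\varphi_\theta(r)=\begin{cases}-\frac{\pi\beta}{2}-\bigl[\beta F_1\sin\bigl(\frac{\pi\beta}{2}+\varphi^*\bigr)\bigr]r^{1-1/\beta}+O(r^\gamma), & \theta\in(0,\theta^* ),\\[1mm] \varphi^*+E_1^*\,r^{2/\beta-1}+o\bigl(r^{2/\beta-1}\bigr), & \theta=\theta^*,\\[1mm] \frac{\pi\beta}{2}-\bigl[\beta F_1\sin\bigl(\frac{\pi\beta}{2}-\varphi^*\bigr)\bigr]r^{1-1/\beta}+O(r^\gamma), & \theta\in(\theta^*,\pi),\end{cases}$$ where $F_1=\mu\,(a_1-b_1\cot\theta)^{-1}$,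 $E_1^*=\mu^{-1}(a_2-b_2\cot\theta^* )\sin\frac{2\varphi^*}{\beta}$ and $\gamma=\min\{1/\beta,\,2(1-1/\beta)\}$.
   Context: Let $z=re^{i\varphi}$ and $w=u+iv=\rho e^{i\theta}$. For $R>0$ let $\mathcal S=\{re^{i\varphi}: r\in(0,R),\ \varphi\in(-\pi\beta/2,\pi\beta/2)\}$ be a sector of angle $\pi\beta$ (for $\beta>1$, angles in $\mathcal S$ are taken in $(-\pi\beta/2,\pi\beta/2)$), with sides $L_\pm=\{r\in(0,R),\ \varphi=\mp\pi\beta/2\}$ (so $L_+$ is the side $\varphi=-\pi\beta/2$), and $L=L_-\cup\{0\}\cup L_+$. The sector $\mathcal S$ is contained in a planar domain $\mathcal Z$ whose boundary contains $L$. $\mathcal F=u+iv$ is a complex-valued harmonic function on $\mathcal Z$ (that is, $u$ and $v$ are real harmonic functions, with no Cauchy–Riemann condition imposed), continuous up to $L$. It maps $\mathcal S\cup L$ homeomorphically onto $\mathcal H\cup\mathcal I$, with $\mathcal F(\mathcal S)=\mathcal H$ and $\mathcal F(L)=\mathcal I$, where $\mathcal H$ is a subdomain of the upper half-plane $\{v>0\}$ adjoining a segment $\mathcal I\ni0$ of the real axis. Its boundary values are $$u=-\sigma_-r\ \text{ on }L_-,\qquad u=\sigma_+r\ \text{ on }L_+,\qquad v=0\ \text{ on }L,$$ with constants $\sigma_-,\sigma_+>0$; in particular $\mathcal F(0)=0$. $\mathcal F^{-1}$ denotes the inverse map $\mathcal H\cup\mathcal I\to\mathcal S\cup L$. Put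 $$\mu=|\sin\pi\beta|^{-1}\sqrt{\sigma_+^2+\sigma_-^2+2\sigma_+\sigma_-\cos\pi\beta}>0,\qquad \varphi^*=\arctan\Bigl(\frac{\sigma_+-\sigma_-}{\sigma_++\sigma_-}\tan\frac{\pi\beta}{2}\Bigr)\in\Bigl(-\frac{\pi\beta}{2},\frac{\pi\beta}{2}\Bigr).$$ The real numbers $a_1,b_1,a_2,b_2$ are the coefficients in the expansion, uniform in $\varphi\in[-\pi\beta/2,\pi\beta/2]$, $$\mathcal F(re^{i\varphi})=-\mu r\sin(\varphi-\varphi^* )+(a_1+ib_1)r^{1/\beta}\cos\frac{\varphi}{\beta}+(a_2+ib_2)r^{2/\beta}\sin\frac{2\varphi}{\beta}+O(r^{3/\beta}),\quad r\to0,$$ which is obtained by truncating the convergent series in $\mathcal S\cup L$ of $\mathcal F+\mu r\sin(\varphi-\varphi^* )$ in the functions $\operatorname{Im}(iz^{1/\beta})^n$, $n\ge1$. One has $b_1>0$. The angle $\theta^*\in(0,\pi)$ is defined by $a_1-b_1\cot\theta^*=0$, i.e. $\theta^*=\arg(a_1+ib_1)$. For $\theta\in(0,\pi)$, $\Lambda_\theta=\{w\in\mathcal H:|w|>0,\ \arg w=\theta\}$ is the ray from $w=0$ at angle $\theta$ and $L_\theta=\mathcal F^{-1}(\Lambda_\theta)$. For $\theta=0$ and $\theta=\pi$, $\Lambda_\theta$ is the part of $\mathcal I$ on the positive, respectively negative, real axis, and again $L_\theta=\mathcal F^{-1}(\Lambda_\theta)$. *)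

(* Defs.v *)
From HB Require Import structures.
From mathcomp Require Import all_boot all_order all_algebra.
From mathcomp Require Import all_classical all_reals all_analysis.
From mathcomp Require Import complex.
Set Implicit Arguments.
Unset Strict Implicit.
Unset Printing Implicit Defensive.
Import Order.TTheory GRing.Theory Num.Theory.
Import numFieldNormedType.Exports.
Local Open Scope classical_set_scope.
Local Open Scope ring_scope.

(* The plane is [R * R] with its product topology: [(x, y)] stands for x + iy,
   and a complex-valued function u + iv is a map into [R * R]. The norm of
   [R * R] is the max norm, which changes O-estimates only by a constant.
   Maps such as F and its inverse are total functions of which only the values
   on the stated domains are meaningful. *)

Section Plane.
Variable R : realType.
Implicit Types (r phi theta : R) (A B Z : set (R * R)).

Definition polar r phi : R * R := (r * cos phi, r * sin phi).

Definition cot (x : R) : R := cos x / sin x.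

Definition boundary A : set (R * R) := closure A `\` interior A.

(* C^2 with vanishing Laplacian; quantifying over all directions e, e'
   includes the two coordinate directions. *)
Definition harmonic_on Z (u : R * R -> R) : Prop :=
  forall z, Z z ->
    (forall e e' : R * R,
       [/\ derivable u z e, derivable ('D_e u) z e' &
           {for z, continuous ('D_e' ('D_e u))}]) /\
    'D_(1, 0) ('D_(1, 0) u) z + 'D_(0, 1) ('D_(0, 1) u) z = 0.

(* f maps A homeomorphically onto B, with inverse map g : B -> A. *)
Definition homeomorphism_on A B (f g : R * R -> R * R) : Prop :=
  [/\ set_bij A B f, {in A, cancel f g},
      {within A, continuous f} & {within B, continuous g}].

Definition upper_half_plane : set (R * R) := [set w | 0 < w.2].

Definition real_segment (I : set (R * R)) : Prop :=
  exists2 J : set R, is_interval J & I = [set (t, 0) | t in J].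

End Plane.

Section Sector.
Variables (R : realType) (rad beta : R).

Definition sector : set (R * R) :=
  [set z | exists r phi, [/\ 0 < r < rad,
     - (pi * beta / 2) < phi < pi * beta / 2 & z = polar r phi]].

(* L_+ is the side phi = - pi beta / 2, and L_- the side phi = pi beta / 2. *)
Definition side_plus : set (R * R) :=
  [set polar r (- (pi * beta / 2)) | r in [set r | 0 < r < rad]].

Definition side_minus : set (R * R) :=
  [set polar r (pi * beta / 2) | r in [set r | 0 < r < rad]].

Definition sides : set (R * R) := side_minus `|` [set (0, 0)] `|` side_plus.

End Sector.

Section Expansion.
Variable R : realType.

Definition mu_of (beta sigmap sigmam : R) : R :=
  `|sin (pi * beta)|^-1 *
  Num.sqrt (sigmap ^+ 2 + sigmam ^+ 2 + 2 * sigmap * sigmam * cos (pi * beta)).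

Definition phistar_of (beta sigmap sigmam : R) : R :=
  atan ((sigmap - sigmam) / (sigmap + sigmam) * tan (pi * beta / 2)).

(* Im (i z^{1/beta})^n for z = r e^{i phi}; the branch of z^{1/beta} is the one
   given by the angle phi, i.e. z^{1/beta} = r^{1/beta} e^{i phi / beta}. *)
Definition sector_harmonic (beta : R) (n : nat) (r phi : R) : R :=
  complex.Im
    ((('i * (r `^ beta^-1 * cos (phi / beta)
             +i* (r `^ beta^-1 * sin (phi / beta)))) ^+ n)%C).

(* The real functions in the expansion are r^{1/beta} cos (phi / beta), equal to
   Im (i z^{1/beta}), and r^{2/beta} sin (2 phi / beta), equal to
   - Im (i z^{1/beta})^2: hence the sign of the coefficient c 2. *)
Definition expansion (beta rad mu phis : R) (F : R * R -> R * R)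
    (a1 b1 a2 b2 : R) : Prop :=
  (exists c : nat -> R * R,
     [/\ c 1%N = (a1, b1), c 2%N = (- a2, - b2) &
       forall r phi, 0 < r < rad ->
         - (pi * beta / 2) <= phi <= pi * beta / 2 ->
         series (fun n => sector_harmonic beta n.+1 r phi *: c n.+1) @ \oo
           --> F (polar r phi) + (mu * r * sin (phi - phis), 0)]) /\
  (exists C : R, \forall r \near 0^'+,
     forall phi, - (pi * beta / 2) <= phi <= pi * beta / 2 ->
       `| F (polar r phi)
          - ((- (mu * r * sin (phi - phis)), 0)
             + (r `^ (1 / beta) * cos (phi / beta)) *: (a1, b1)
             + (r `^ (2 / beta) * sin (2 * phi / beta)) *: (a2, b2)) |
         <= C * r `^ (3 / beta)).

(* The ray Lambda_theta, 0 <= theta <= pi. *)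
Definition ray (H I : set (R * R)) (theta : R) : set (R * R) :=
  [set w | (if 0 < theta < pi then H w else I w) /\
           exists2 rho, 0 < rho & w = polar rho theta].

(* phi = f r is the equation of the curve A, in polar coordinates with angles
   in [- pi beta / 2, pi beta / 2], in a punctured neighbourhood of 0. *)
Definition polar_equation (beta : R) (A : set (R * R)) (f : R -> R) : Prop :=
  \forall r \near 0^'+,
    - (pi * beta / 2) <= f r <= pi * beta / 2 /\
    forall phi, - (pi * beta / 2) <= phi <= pi * beta / 2 ->
      (A (polar r phi) <-> phi = f r).

End Expansion.

(* Main.v *)
Require Import Defs.
From HB Require Import structures.
From mathcomp Require Import all_boot all_order all_algebra.
From mathcomp Require Import all_classical all_reals all_analysis.
From mathcomp Require Import complex zify ring lra.
Set Implicit Arguments.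
Unset Strict Implicit.
Unset Printing Implicit Defensive.
Import Order.TTheory GRing.Theory Num.Theory.
Import numFieldNormedType.Exports.
Local Open Scope classical_set_scope.
Local Open Scope ring_scope.

(** Write [B = pi beta / 2]. Since [v > 0] inside the sector, a point there lies
    on the curve [L_theta] exactly when [g = u - v cot theta] vanishes at it. By
    the expansion of [F], with [A = a1 - b1 cot theta] and
    [D = a2 - b2 cot theta],
<<
  g r x = - mu r sin (x - phis) + A r^(1/beta) cos (x/beta)
          + D r^(2/beta) sin (2x/beta) + O(r^(3/beta)),
>>
    and [g] equals [sigmap r > 0] on the side [x = - B] and [- sigmam r < 0] on
    the side [x = B]. So for each small [r] there is a zero [x], by the
    intermediate value theorem, and the theorem says where it is.

    A bound on the remainder locates the zeros but does not show that there is
    only one: this needs control of the dependence on the angle. It comes from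
    the convergent series. Its n-th term is [d n r^(n/beta) sin (n psi)] with
    [psi = pi/2 + x/beta], and convergence for the single angle with
    [cos psi = 1/4] already bounds [d n] geometrically
    ([sine_coefficients_growth]), because there [|sin (n psi)|] decays at most
    geometrically ([norm_sin_multiple_ge]). Hence each remainder of the series
    is Lipschitz in [x] with a constant of the order of its first term
    ([sine_series_remainder], [level_expansion]). As all the terms vanish on the
    sides, the Lipschitz bounds also give the size of the remainders.

    What is left is a comparison of exponents.
    - If the linear term dominates, that is if [beta < 1], or [beta > 1] and
      [A = 0], then [g / r] is a small Lipschitz perturbation of
      [- mu sin (x - phis)], whose only zero in the sector is simple. The zero
      persists, is unique, and moves to first order by the value of the
      perturbation at [phis] divided by [mu]
      ([transversal_zero_unique], [transversal_zero_expansion]).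
    - If [beta > 1] and [A] is not zero, then [g / r^(1/beta)] is a small
      perturbation of [A cos (x/beta)], which vanishes only at the two sides.
      The boundary signs of [g] allow a zero near just one of them, the side
      [x = - B] when [A < 0] and [x = B] when [A > 0]; there the balance of
      [A cos (x/beta)] with the linear term gives the angle
      ([endpoint_zero_near], [endpoint_zero_unique],
      [endpoint_zero_expansion]).

    The cotangent decreases on [(0, pi)] and [b1 > 0], so [A] is negative, zero
    or positive according as [theta] is less than, equal to or greater than
    [thetas]. *)

(** * Elementary estimates for sine and cosine *)

Section Trigonometry.
Variable R : realType.
Implicit Types x y a b m M : R.

Lemma sin_mean_value a b : a <= b ->
  exists2 c, a <= c <= b & sin b - sin a = cos c * (b - a).
Proof.
move=> ab.
have hd x : x \in `]a, b[ -> is_derive x 1 (@sin R) (cos x).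
  by move=> _; exact: is_derive_sin.
have [|c ci ->] := MVT_segment ab hd.
  exact/continuous_subspaceT/continuous_sin.
by exists c => //; move: ci; rewrite in_itv.
Qed.

Lemma sin_incr_ge m a b : a <= b ->
  (forall c, a <= c <= b -> m <= cos c) -> m * (b - a) <= sin b - sin a.
Proof.
move=> ab hm; have [c ci ->] := sin_mean_value ab.
by rewrite ler_wpM2r ?subr_ge0 ?hm.
Qed.

Lemma sin_lipschitz x y : `|sin x - sin y| <= `|x - y|.
Proof.
wlog xy : x y / y <= x => [hw|].
  by have [/hw//|/ltW/hw] := leP y x; rewrite distrC (distrC y).
have [c _ ->] := sin_mean_value xy.
by rewrite normrM ler_piMl // cos_max.
Qed.

Lemma cos_lipschitz x y : `|cos x - cos y| <= `|x - y|.
Proof.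
rewrite -!sinDpihalf; apply: le_trans (sin_lipschitz _ _) _.
by rewrite opprD addrACA subrr addr0.
Qed.

Lemma cos_ge_half x : `|x| <= 1 / 2 -> 1 / 2 <= cos x.
Proof.
move=> hx; have := cos_lipschitz x 0; rewrite cos0 subr0 => /le_trans/(_ hx).
by rewrite ler_norml => /andP[? _]; lra.
Qed.

Lemma sin_sub_id_le x : `|sin x - x| <= x ^+ 2.
Proof.
have key y : 0 <= y -> `|sin y - y| <= y ^+ 2.
  move=> y0; have [c /andP[c0 cy]] := sin_mean_value y0.
  rewrite sin0 !subr0 => ->.
  rewrite (_ : cos c * y - y = (cos c - 1) * y); last by ring.
  rewrite normrM expr2 (ger0_norm y0) ler_wpM2r //.
  have := cos_lipschitz c 0; rewrite cos0 subr0 => /le_trans; apply.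
  by rewrite ger0_norm.
have [/key//|/ltW x0] := leP 0 x.
have := key (- x); rewrite oppr_ge0 sinN sqrrN => /(_ x0).
by rewrite -opprD normrN.
Qed.

(** Writing [sin x = 2 sin (x/2) cos (x/2)] keeps both factors away from their
    zeros as long as [x] stays away from [pi]. *)
Lemma sin_ge_linear M x : 0 <= x <= M -> M < pi ->
  cos (M / 2) ^+ 2 * x <= sin x.
Proof.
move=> /andP[x0 xM] Mpi.
have cM : 0 < cos (M / 2).
  by apply: cos_gt0_pihalf; have := pi_gt0 R; lra.
have hc c : 0 <= c <= x / 2 -> cos (M / 2) <= cos c.
  move=> /andP[c0 cx]; have := @ltr_cos R => lc.
  by rewrite leNgt lc ?in_itv /= -?leNgt; have := pi_gt0 R; lra.
have h2 : cos (M / 2) * (x / 2) <= sin (x / 2).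
  have := @sin_incr_ge (cos (M / 2)) 0 (x / 2) _ hc.
  by rewrite sin0 !subr0; apply; rewrite divr_ge0.
have h3 : cos (M / 2) <= cos (x / 2) by apply: hc; rewrite lexx divr_ge0.
have -> : sin x = 2 * (cos (x / 2) * sin (x / 2)).
  rewrite [in LHS](_ : x = (x / 2) *+ 2) ?sin_mulr2n ?mulr_natl //.
  by field.
have h4 : 0 <= cos (M / 2) * (x / 2) by rewrite mulr_ge0 ?divr_ge0 // ltW.
have : cos (M / 2) * (cos (M / 2) * (x / 2)) <= cos (x / 2) * sin (x / 2).
  by rewrite ler_pM // ltW.
by rewrite expr2; lra.
Qed.

Lemma norm_sin_ge_linear M x : `|x| <= M -> M < pi ->
  cos (M / 2) ^+ 2 * `|x| <= `|sin x|.
Proof.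
move=> hx Mpi; have := @sin_ge_linear M `|x|; rewrite normr_ge0 => /(_ hx Mpi).
move=> /le_trans; apply; have [_|_] := ger0P x; first exact: ler_norm.
by rewrite -normrN -sinN ler_norm.
Qed.

Lemma sin_ge_half x : 0 <= x <= pi / 2 -> x / 2 <= sin x.
Proof.
move=> hx; have := sin_ge_linear hx.
have -> : cos (pi / 2 / 2) ^+ 2 = 1 / 2 :> R.
  have := cos_mulr2n (pi / 2 / 2 : R).
  rewrite (_ : (pi / 2 / 2) *+ 2 = pi / 2 :> R); last by field.
  by rewrite cos_pihalf; lra.
by have := pi_gt0 R; lra.
Qed.

End Trigonometry.

(** * Sine series with geometric coefficients *)

Section SineSeries.
Variable R : realType.
Implicit Types (d : nat -> R) (s x y psi K q : R).

Definition sine_term d s x (n : nat) : R :=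
  d n.+1 * s ^+ n.+1 * sin (n.+1%:R * x).

(** The numbers [w n = 2 ^ n sin ((n + 1) psi) / sin psi] satisfy the recurrence
    [w (n + 2) = w (n + 1) - 4 w n] with [w 0 = w 1 = 1]: they are odd integers,
    hence at least 1 in absolute value. *)
Lemma norm_sin_multiple_ge psi n : cos psi = 1 / 4 ->
  `|sin psi| <= 2 ^+ n * `|sin (n.+1%:R * psi)|.
Proof.
move=> cpsi.
pose odd_multiple m := exists k : int,
  2 ^+ m * sin (m.+1%:R * psi) = sin psi * (2 * k + 1)%:~R :> R.
suff /(_ n) [[k hk] _] : forall m, odd_multiple m /\ odd_multiple m.+1.
  have -> : 2 ^+ n * `|sin (n.+1%:R * psi)| = `|2 ^+ n * sin (n.+1%:R * psi)|.
    by rewrite normrM (ger0_norm (exprn_ge0 _ _)).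
  rewrite hk normrM ler_peMr // -intr_norm (_ : 1 = 1%:~R) // ler_int.
  have : (2 * k + 1 != 0)%R by apply/eqP; lia.
  by rewrite -normr_gt0.
elim=> [|m [[k0 h0] [k1 h1]]]; first split.
- by exists 0; rewrite expr0 !mul1r mulr0 add0r mulr1.
- exists 0; rewrite mulr0 add0r mulr1 expr1.
  rewrite (_ : 2%:R * psi = psi *+ 2) ?mulr_natl // sin_mulr2n cpsi.
  by rewrite -mulr_natl; field.
split; first by exists k1.
exists (k1 - 4 * k0 - 2).
pose c := m.+2%:R * psi.
have e2 : m.+3%:R * psi = c + psi by rewrite /c -[m.+3]addn1 natrD; ring.
have e0 : m.+1%:R * psi = c - psi by rewrite /c -[m.+2]addn1 natrD; ring.
move: h0 h1; rewrite e0 e2 -/c sinB sinD cpsi !exprS.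
rewrite !(rmorphD, rmorphM, rmorphB, rmorphN) /=.
set E := 2 ^+ m; set S := sin c; set C := cos c * sin psi => h0 h1.
by rewrite mulrDr; lra.
Qed.

(** The terms of a convergent series are bounded. Dividing by the sine, which is
    at least of order [2 ^ - n] at this angle, only shrinks the radius of
    convergence, and so does the factor [n]. *)
Lemma sine_coefficients_growth d s x : 0 < s -> cos x = 1 / 4 ->
  cvgn (series (sine_term d s x)) ->
  exists K q, [/\ 0 <= K, 0 < q &
    forall n, `|d n.+1| * n.+1%:R <= K * q ^+ n.+1].
Proof.
move=> s0 cx /cvg_series_bounded [M0 [_ hM]].
pose M := M0 + 1; have {}hM n : `|sine_term d s x n| <= M.
  by apply: hM => //; rewrite /M ltrDl.
have M_ge0 : 0 <= M := le_trans (normr_ge0 _) (hM 0%N).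
have sx : 0 < `|sin x|.
  rewrite normr_gt0; apply/eqP => sx0; have := cos2Dsin2 x.
  by rewrite cx sx0; lra.
exists (M / `|sin x|), (4 / s); split; [exact: divr_ge0|exact: divr_gt0|].
move=> n; have := hM n; rewrite /sine_term !normrM normrX (gtr0_norm s0).
have := norm_sin_multiple_ge n cx.
set D := `|d n.+1|; set S := `|sin (n.+1%:R * x)| => h1 h2.
rewrite expr_div_n mulrACA -invfM ler_pdivlMr; last first.
  by rewrite mulr_gt0 ?exprn_gt0.
have n2 : (n.+1%:R : R) <= 2 ^+ n.+1.
  have := ltnW (ltn_expl n.+1 (ltnSn 1)).
  by rewrite -(ler_nat R) natrX.
have -> : (4 : R) ^+ n.+1 = 2 * 2 ^+ n * 2 ^+ n.+1.
  by rewrite -exprS -exprMn -natrM.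
have : 0 <= s ^+ n.+1 by rewrite exprn_ge0 // ltW.
have : 0 <= (2 : R) ^+ n by rewrite exprn_ge0.
have : 0 <= (2 : R) ^+ n.+1 by rewrite exprn_ge0.
move: n2 h1 h2 (normr_ge0 (d n.+1)) (ler0n R n.+1); rewrite -/D.
move: D S (n.+1%:R) (s ^+ n.+1) (2 ^+ n) (2 ^+ n.+1) => D S N a p p' /=.
move=> Np' h1 h2 D0 N0 p'0 p0 a0.
have h3 : `|sin x| * (D * a) <= p * M.
  apply: le_trans (ler_wpM2r (mulr_ge0 D0 a0) h1) _.
  by rewrite (_ : p * S * (D * a) = p * (D * a * S)) ?ler_wpM2l //; ring.
have -> : D * N * (`|sin x| * a) = (`|sin x| * (D * a)) * N by ring.
apply: le_trans (_ : p * M * p' <= _).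
  by rewrite ler_pM // !mulr_ge0.
by have : 0 <= p * M * p'; [rewrite !mulr_ge0|lra].
Qed.

Lemma sum_geometric_tail_le (z : R) N m : 0 <= z <= 1 / 2 ->
  \sum_(N <= i < N + m) z ^+ i.+1 <= 2 * z ^+ N.+1.
Proof.
move=> /andP[z0 z1].
suff h : \sum_(N <= i < N + m) z ^+ i.+1 <= 2 * z ^+ N.+1 - 2 * z ^+ (N + m).+1.
  by apply: le_trans h _; rewrite gerBl mulr_ge0 ?exprn_ge0.
elim: m => [|m IH]; first by rewrite addn0 big_geq // subrr.
rewrite addnS big_nat_recr ?leq_addr //=.
have : z ^+ (N + m).+2 <= 1 / 2 * z ^+ (N + m).+1.
  by rewrite exprS ler_wpM2r ?exprn_ge0.
by lra.
Qed.

(** Differentiating the n-th term with respect to the angle costs only a factor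
    [n], which geometric decay absorbs: the remainder after [N] terms is
    Lipschitz in the angle with a constant of the order of its first term. *)
Lemma sine_remainder_lipschitz d K q s N x y Gx Gy :
  0 <= K -> 0 < q -> (forall n, `|d n.+1| * n.+1%:R <= K * q ^+ n.+1) ->
  0 <= s -> q * s <= 1 / 2 ->
  series (sine_term d s x) @ \oo --> Gx ->
  series (sine_term d s y) @ \oo --> Gy ->
  `|(Gx - series (sine_term d s x) N) - (Gy - series (sine_term d s y) N)|
    <= 2 * K * (q * s) ^+ N.+1 * `|x - y|.
Proof.
move=> K0 q0 hd s0 qs hx hy.
have qs0 : 0 <= q * s by rewrite mulr_ge0 // ltW.
set P := series _ N; set Q := series _ N.
have hcv : (fun n => `|(series (sine_term d s x) n - P)
                    - (series (sine_term d s y) n - Q)|) @ \oo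
           --> `|(Gx - P) - (Gy - Q)|.
  by apply: cvg_norm; apply: cvgB; apply: cvgB => //; exact: cvg_cst.
apply: (cvgr_to_le hcv); near=> n.
have Nn : (N <= n)%N by near: n; exact: nbhs_infty_ge.
rewrite /P /Q !sub_series_geq // -sumrB.
apply: le_trans (ler_norm_sum _ _ _) _.
rewrite -(subnKC Nn).
have -> : 2 * K * (q * s) ^+ N.+1 * `|x - y|
        = K * `|x - y| * (2 * (q * s) ^+ N.+1) by ring.
apply: le_trans (_ : K * `|x - y|
  * (\sum_(N <= i < N + (n - N)) (q * s) ^+ i.+1) <= _); last first.
  rewrite ler_wpM2l ?mulr_ge0 //.
  by apply: sum_geometric_tail_le; rewrite qs0.
rewrite mulr_sumr; apply: ler_sum => i _.
rewrite /sine_term -mulrBr !normrM normrX (ger0_norm s0).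
have h1 : `|sin (i.+1%:R * x) - sin (i.+1%:R * y)| <= i.+1%:R * `|x - y|.
  by apply: le_trans (sin_lipschitz _ _) _; rewrite -mulrBr normrM normr_nat.
apply: le_trans (_ : `|d i.+1| * s ^+ i.+1 * (i.+1%:R * `|x - y|) <= _).
  by rewrite ler_wpM2l ?mulr_ge0 ?exprn_ge0.
have := hd i; rewrite exprMn => /(ler_wpM2r (_ : 0 <= s ^+ i.+1 * `|x - y|)).
rewrite mulr_ge0 ?exprn_ge0 // => /(_ isT).
by lra.
Unshelve. all: by end_near. Qed.

End SineSeries.

(** * Zeros of perturbed trigonometric functions *)

Section ZeroPerturbation.
Variable R : realType.
Implicit Types (delta eta beta mu phis lo hi x y h : R) (e : R -> R -> R).

Lemma near0_powR_le delta eps : 0 < delta -> 0 < eps ->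
  \forall r \near (0 : R)^'+, r `^ delta <= eps.
Proof.
move=> d0 e0; by apply: (cvgr_le 0 (powR_cvg0 d0)).
Qed.

Lemma near0_mul_powR_le delta (K eps : R) : 0 < delta -> 0 <= K -> 0 < eps ->
  \forall r \near (0 : R)^'+, K * r `^ delta <= eps.
Proof.
move=> d0 K0 e0; have K1 : 0 < K + 1 by rewrite ltr_wpDl.
have := near0_powR_le d0 (divr_gt0 e0 K1); apply: filterS => r.
rewrite ler_pdivlMr // => h; apply: le_trans h.
by rewrite mulrC ler_wpM2l ?powR_ge0 // lerDl.
Qed.

Lemma near0_powR_antimono delta eta : delta <= eta ->
  \forall r \near (0 : R)^'+, r `^ eta <= r `^ delta.
Proof.
move=> de; near=> r; apply: ger_powR => //; apply/andP; split.
  by near: r; exact: nbhs_right_gt.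
by near: r; exact: nbhs_right_le.
Unshelve. all: by end_near. Qed.

(** In [e r x] the first argument is a radius and the second an angle. *)
Definition lipschitz_rate lo hi delta (C : R) e :=
  \forall r \near (0 : R)^'+, forall x y, lo <= x <= hi -> lo <= y <= hi ->
    `|e r x - e r y| <= C * r `^ delta * `|x - y|.

Section Transversal.
Variables (mu phis lo hi M delta eta h C : R) (e : R -> R -> R).
Hypotheses (mu0 : 0 < mu) (phisI : lo <= phis <= hi) (Mpi : M < pi).
Hypothesis hM : forall x, lo <= x <= hi -> `|x - phis| <= M.
Hypotheses (delta0 : 0 < delta) (delta_eta : delta < eta) (C0 : 0 <= C).
Hypothesis e_lip : lipschitz_rate lo hi delta C e.
Hypothesis e_phis :
  \forall r \near 0^'+, `|e r phis - h * r `^ delta| <= C * r `^ eta.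

Definition transversal_zero r x := lo <= x <= hi /\ mu * sin (x - phis) = e r x.

(** At a zero [sin (x - phis)] is of the order of [e], and [M < pi] keeps
    [x - phis] away from the other zeros of the sine. *)
Lemma transversal_zero_near : exists2 K, 0 <= K &
  \forall r \near 0^'+, forall x, transversal_zero r x ->
    `|x - phis| <= K * r `^ delta.
Proof.
have M0 : 0 <= M := le_trans (normr_ge0 _) (hM phisI).
pose m := cos (M / 2) ^+ 2.
have m0 : 0 < m.
  apply/exprn_gt0/cos_gt0_pihalf; have := pi_gt0 R; move: M0 Mpi; lra.
pose k := `|h| + C + C * M.
have k0 : 0 <= k by rewrite !addr_ge0 ?mulr_ge0.
exists (k / (mu * m)); first by rewrite divr_ge0 // ltW // mulr_gt0.
near=> r.
have hl : forall x y, lo <= x <= hi -> lo <= y <= hi ->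
    `|e r x - e r y| <= C * r `^ delta * `|x - y| by near: r.
have hp : `|e r phis - h * r `^ delta| <= C * r `^ eta by near: r.
have hr : r `^ eta <= r `^ delta.
  by near: r; exact/near0_powR_antimono/ltW.
move=> x [xI zx]; have {}hl := hl _ _ xI phisI.
have hs := norm_sin_ge_linear (hM xI) Mpi.
have d0 := powR_ge0 r delta.
have h1 : mu * `|sin (x - phis)| <= k * r `^ delta.
  rewrite -(gtr0_norm mu0) -normrM zx.
  have -> : e r x = (e r x - e r phis) + (e r phis - h * r `^ delta)
                    + h * r `^ delta by ring.
  apply: le_trans (ler_normD _ _) _; rewrite normrM (ger0_norm d0).
  have := ler_normD (e r x - e r phis) (e r phis - h * r `^ delta).
  have : C * r `^ eta <= C * r `^ delta by rewrite ler_wpM2l.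
  have : C * r `^ delta * `|x - phis| <= C * r `^ delta * M.
    by rewrite ler_wpM2l ?hM // mulr_ge0.
  by rewrite /k; lra.
rewrite mulrAC ler_pdivlMr; last exact: mulr_gt0.
apply: le_trans h1.
by rewrite mulrC -mulrA ler_pM2l.
Unshelve. all: by end_near. Qed.

(** Close to [phis] the function [mu sin (x - phis)] has slope at least
    [mu / 2], while [e r] has Lipschitz constant at most [mu / 4]. *)
Lemma transversal_zero_unique :
  \forall r \near 0^'+, forall x y,
    transversal_zero r x -> transversal_zero r y -> x = y.
Proof.
have [K K0 hK] := transversal_zero_near.
near=> r.
have hl : forall x y, lo <= x <= hi -> lo <= y <= hi ->
    `|e r x - e r y| <= C * r `^ delta * `|x - y| by near: r.
have hk : forall x, transversal_zero r x -> `|x - phis| <= K * r `^ delta.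
  by near: r.
have hK2 : K * r `^ delta <= 1 / 2 by near: r; exact: near0_mul_powR_le.
have small x : transversal_zero r x -> `|x - phis| <= 1 / 2.
  by move=> zx; exact: le_trans (hk _ zx) hK2.
have hC : C * r `^ delta <= mu / 4.
  by near: r; apply: near0_mul_powR_le => //; rewrite divr_gt0.
have le_zero x y : transversal_zero r x -> transversal_zero r y -> y <= x.
  move=> zx zy; rewrite leNgt; apply/negP => xy.
  move: (small _ zx) (small _ zy); rewrite !ler_norml => /andP[x1 x2] /andP[y1 y2].
  have := @sin_incr_ge _ (1 / 2) (x - phis) (y - phis).
  rewrite lerD2r => /(_ (ltW xy)) h1.
  have {h1} : 1 / 2 * (y - x) <= sin (y - phis) - sin (x - phis).
    rewrite (_ : y - x = y - phis - (x - phis)); last by ring.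
    apply: h1 => c /andP[c1 c2].
    by apply: cos_ge_half; rewrite ler_norml; apply/andP; split; lra.
  rewrite -(ler_pM2l mu0) [mu * (sin _ - _)]mulrBr zx.2 zy.2 => h1.
  have h2 := hl _ _ zy.1 zx.1.
  have yx : 0 < y - x by rewrite subr_gt0.
  have h3 : C * r `^ delta * `|y - x| <= mu / 4 * (y - x).
    by rewrite (gtr0_norm yx) ler_pM2r.
  have := ler_norm (e r y - e r x).
  have : 0 < mu * (y - x) by rewrite mulr_gt0.
  by lra.
by move=> x y zx zy; apply/eqP; rewrite eq_le !le_zero.
Unshelve. all: by end_near. Qed.

(** At a zero, [mu (x - phis)] agrees with [e r phis] up to the quadratic error
    of the sine and the variation of [e r] between [phis] and [x], both of order
    [r `^ (2 * delta)]. *)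
Lemma transversal_zero_expansion (f : R -> R) :
  (\forall r \near 0^'+, transversal_zero r (f r)) ->
  (fun r => f r - (phis + mu^-1 * h * r `^ delta))
    =o_ (0^'+) (fun r => r `^ delta).
Proof.
move=> zf; have [K K0 hK] := transversal_zero_near.
have mu1 : 0 <= mu^-1 by rewrite invr_ge0 ltW.
apply/eqoP => eps eps0; near=> r.
have zr : transversal_zero r (f r) by near: r.
have hl : forall x y, lo <= x <= hi -> lo <= y <= hi ->
    `|e r x - e r y| <= C * r `^ delta * `|x - y| by near: r.
have hk : forall x, transversal_zero r x -> `|x - phis| <= K * r `^ delta.
  by near: r.
have {}hl := hl _ _ zr.1 phisI; have {}hk := hk _ zr.
have hp : `|e r phis - h * r `^ delta| <= C * r `^ eta by near: r.
have r0 : 0 < r by near: r; exact: nbhs_right_gt.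
have h1 : (K ^+ 2 + mu^-1 * C * K) * r `^ delta <= eps / 2.
  near: r; apply: near0_mul_powR_le; rewrite ?divr_gt0 //.
  by rewrite addr_ge0 ?sqr_ge0 ?mulr_ge0.
have h2 : mu^-1 * C * r `^ (eta - delta) <= eps / 2.
  near: r; apply: near0_mul_powR_le; rewrite ?subr_gt0 ?divr_gt0 //.
  by rewrite mulr_ge0.
have d0 := powR_ge0 r delta.
have hs := sin_sub_id_le (f r - phis).
have e1 : r `^ eta = r `^ (eta - delta) * r `^ delta.
  by rewrite -powRD ?subrK ?(gt_eqF r0) ?implybT.
rewrite (ger0_norm d0).
have -> : f r - (phis + mu^-1 * h * r `^ delta)
  = - (sin (f r - phis) - (f r - phis))
    + mu^-1 * (e r (f r) - e r phis) + mu^-1 * (e r phis - h * r `^ delta).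
  by rewrite -zr.2; field; rewrite gt_eqF.
apply: le_trans (ler_normD _ _) _.
apply: le_trans (lerD (ler_normD _ _) (lexx _)) _.
rewrite normrN !normrM (ger0_norm mu1).
have q1 : (f r - phis) ^+ 2 <= (K * r `^ delta) ^+ 2.
  by rewrite -real_normK ?num_real //; apply: lerXn2r; rewrite ?nnegrE ?mulr_ge0.
have q2 : mu^-1 * `|e r (f r) - e r phis|
          <= mu^-1 * (C * r `^ delta * (K * r `^ delta)).
  rewrite ler_wpM2l //; apply: le_trans hl _.
  by rewrite ler_wpM2l // mulr_ge0.
have q3 : mu^-1 * `|e r phis - h * r `^ delta|
          <= mu^-1 * (C * (r `^ (eta - delta) * r `^ delta)).
  by rewrite ler_wpM2l // -e1.
have := ler_wpM2r d0 h1; have := ler_wpM2r d0 h2.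
move: q1 q2 q3 hs; move: (r `^ delta) (r `^ (eta - delta)) => a b.
by rewrite exprMn !expr2; lra.
Unshelve. all: by end_near. Qed.

End Transversal.

Section Endpoint.
Variables (beta A delta s1 C : R) (e : R -> R -> R).
Let B := pi * beta / 2.
Hypotheses (beta0 : 0 < beta) (A0 : 0 < A) (delta0 : 0 < delta).
Hypotheses (s1_ge0 : 0 <= s1) (C0 : 0 <= C).
Hypothesis e_lip : lipschitz_rate (- B) B delta C e.
Hypothesis e_left : \forall r \near 0^'+, e r (- B) = s1 * r `^ delta.
Hypothesis e_right : \forall r \near 0^'+, e r B < 0.

Definition endpoint_zero r x :=
  - B <= x <= B /\ A * cos (x / beta) = e r x.

(** With [x = B - beta t] the equation reads [A sin t = e r x], and [e r x] is
    at most [e r B < 0] plus a multiple of [r ^ delta * t], too small to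
    compensate: all zeros are in the left half, where the same estimate bounds
    [t] in [x = - B + beta t]. *)
Lemma endpoint_zero_near :
  \forall r \near 0^'+, forall x, endpoint_zero r x ->
    exists2 t, 0 <= t <= 4 * s1 / A * r `^ delta /\ t <= pi / 2 &
               x = - B + beta * t.
Proof.
near=> r.
have hl : forall x y, - B <= x <= B -> - B <= y <= B ->
    `|e r x - e r y| <= C * r `^ delta * `|x - y| by near: r.
have el : e r (- B) = s1 * r `^ delta by near: r.
have er : e r B < 0 by near: r.
have hC : C * beta * r `^ delta <= A / 4.
  by near: r; apply: near0_mul_powR_le; rewrite ?mulr_ge0 ?divr_gt0 // ltW.
have d0 := powR_ge0 r delta.
have B0 : 0 < B by rewrite /B divr_gt0 ?mulr_gt0 ?pi_gt0.
move=> x [xI zx]; move: (xI) => /andP[xl xr].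
have quarter t : 0 <= t -> C * r `^ delta * (beta * t) <= A / 4 * t.
  move=> t0; rewrite (_ : _ * (beta * t) = C * beta * r `^ delta * t); last by ring.
  by rewrite ler_wpM2r.
have half t : 0 <= t <= pi / 2 -> A / 2 * t <= A * sin t.
  by move=> /sin_ge_half; rewrite -(ler_pM2l A0); lra.
have t_range y : 0 <= y <= B -> 0 <= y / beta <= pi / 2.
  move=> /andP[y0 yB]; apply/andP; split; first by rewrite divr_ge0 // ltW.
  by rewrite ler_pdivrMr // mulrAC.
have [x0|x0] := leP 0 x.
  (* The right half: the equation fails, even at the endpoint [t = 0]. *)
  pose t := (B - x) / beta.
  have tI : 0 <= t <= pi / 2 by apply: t_range; lra.
  have t0 : 0 <= t by case/andP: tI.
  have xE : x = B - beta * t by rewrite /t mulrC divfK ?gt_eqF // subKr.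
  have cE : cos (x / beta) = sin t.
    rewrite -(cosBpihalf t) -cosN; congr cos.
    by rewrite xE /B; field; rewrite gt_eqF.
  have := hl x B xI; rewrite lexx andbT => /(_ (ltW (lt_trans _ B0))).
  rewrite oppr_lt0 => /(_ B0).
  have -> : `|x - B| = beta * t.
    by rewrite xE addrAC subrr add0r normrN ger0_norm // mulr_ge0 // ltW.
  move=> /(le_trans (ler_norm _)); have := quarter t t0; have := half t tI.
  rewrite -cE zx; have : 0 <= A * t by rewrite mulr_ge0 // ltW.
  by lra.
(* Here [A t / 2 <= A sin t = e r x <= s1 r ^ delta + A t / 4], which gives the
   constant [4 s1 / A]. *)
pose t := (B + x) / beta.
have tI : 0 <= t <= pi / 2 by apply: t_range; lra.
have t0 : 0 <= t by case/andP: tI.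
have xE : x = - B + beta * t by rewrite /t mulrC divfK ?gt_eqF // addKr.
exists t => //; split; last by case/andP: tI.
rewrite t0 /= mulrAC ler_pdivlMr //.
have cE : cos (x / beta) = sin t.
  by rewrite -(cosBpihalf t); congr cos; rewrite xE /B; field; rewrite gt_eqF.
have BI : - B <= - B <= B by rewrite lexx /=; lra.
have := hl x (- B) xI BI; rewrite el.
have -> : `|x - - B| = beta * t.
  by rewrite xE opprK addrAC addNr add0r ger0_norm // mulr_ge0 // ltW.
move=> /(le_trans (ler_norm _)); have := quarter t t0; have := half t tI.
by rewrite -cE zx; lra.
Unshelve. all: by end_near. Qed.

Let cos_left t : cos ((- B + beta * t) / beta) = sin t.
Proof.
by rewrite -(cosBpihalf t); congr cos; rewrite /B; field; rewrite gt_eqF.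
Qed.

(** By [endpoint_zero_near] all zeros have a small [t], where [A sin t] has
    slope at least [A / 2], against at most [A / 4] for [e r (- B + beta t)]. *)
Lemma endpoint_zero_unique :
  \forall r \near 0^'+, forall x y,
    endpoint_zero r x -> endpoint_zero r y -> x = y.
Proof.
near=> r.
have hl : forall x y, - B <= x <= B -> - B <= y <= B ->
    `|e r x - e r y| <= C * r `^ delta * `|x - y| by near: r.
have hz : forall x, endpoint_zero r x ->
    exists2 t, 0 <= t <= 4 * s1 / A * r `^ delta /\ t <= pi / 2 &
               x = - B + beta * t by near: r; exact: endpoint_zero_near.
have hC : C * beta * r `^ delta <= A / 4.
  by near: r; apply: near0_mul_powR_le; rewrite ?mulr_ge0 ?divr_gt0 // ltW.
have hK : 4 * s1 / A * r `^ delta <= 1 / 2.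
  by near: r; apply: near0_mul_powR_le; rewrite ?divr_ge0 ?mulr_ge0 // ltW.
have le_zero x y : endpoint_zero r x -> endpoint_zero r y -> y <= x.
  move=> zx zy; rewrite leNgt; apply/negP => xy.
  have [t [/andP[t0 tK] _] tE] := hz _ zx.
  have [t' [/andP[t'0 t'K] _] t'E] := hz _ zy.
  have tt' : t < t' by move: xy; rewrite tE t'E ltrD2l ltr_pM2l.
  have h1 : 1 / 2 * (t' - t) <= sin t' - sin t.
    apply: sin_incr_ge (ltW tt') _ => c /andP[c1 c2].
    by apply: cos_ge_half; rewrite ler_norml; apply/andP; split; lra.
  move: h1; rewrite -(ler_pM2l A0) [A * (sin _ - _)]mulrBr.
  rewrite -(cos_left t) -(cos_left t') -tE -t'E zx.2 zy.2.
  have := le_trans (ler_norm _) (hl _ _ zy.1 zx.1).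
  rewrite (_ : y - x = beta * (t' - t)); last by rewrite tE t'E; ring.
  have d : 0 < t' - t by rewrite subr_gt0.
  rewrite gtr0_norm ?mulr_gt0 //.
  have := ler_wpM2r (ltW d) hC.
  have : 0 < A * (t' - t) by rewrite mulr_gt0.
  by lra.
by move=> x y zx zy; apply/eqP; rewrite eq_le !le_zero.
Unshelve. all: by end_near. Qed.

(** The equation is [A sin t = s1 r ^ delta + O(r ^ delta t)], and [t] is itself
    of order [r ^ delta]. *)
Lemma endpoint_zero_expansion (f : R -> R) :
  (\forall r \near 0^'+, endpoint_zero r (f r)) ->
  exists2 K, 0 <= K & \forall r \near 0^'+,
    `|f r - (- B + beta * s1 / A * r `^ delta)| <= K * r `^ (2 * delta).
Proof.
move=> zf; set k := 4 * s1 / A.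
have k0 : 0 <= k by rewrite divr_ge0 ?mulr_ge0 // ltW.
exists (beta * (k ^+ 2 + A^-1 * (C * beta * k))).
  rewrite mulr_ge0 ?addr_ge0 ?sqr_ge0 ?mulr_ge0 ?invr_ge0 // ltW //.
near=> r.
have hl : forall x y, - B <= x <= B -> - B <= y <= B ->
    `|e r x - e r y| <= C * r `^ delta * `|x - y| by near: r.
have hz : forall x, endpoint_zero r x ->
    exists2 t, 0 <= t <= k * r `^ delta /\ t <= pi / 2 &
               x = - B + beta * t by near: r; exact: endpoint_zero_near.
have el : e r (- B) = s1 * r `^ delta by near: r.
have zr : endpoint_zero r (f r) by near: r.
have r0 : 0 < r by near: r; exact: nbhs_right_gt.
have [t [/andP[t0 tk] _] tE] := hz _ zr.
have B0 : 0 < B by rewrite /B divr_gt0 ?mulr_gt0 ?pi_gt0.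
have BI : - B <= - B <= B by rewrite lexx /=; lra.
have := hl _ _ zr.1 BI; rewrite el -zr.2 tE cos_left opprK addrAC addNr add0r.
rewrite (ger0_norm (mulr_ge0 (ltW beta0) t0)) => h1.
have h2 := sin_sub_id_le t.
have h3 : t ^+ 2 <= (k * r `^ delta) ^+ 2.
  by apply: lerXn2r; rewrite ?nnegrE ?(mulr_ge0 k0 (powR_ge0 _ _)).
have -> : r `^ (2 * delta) = r `^ delta * r `^ delta.
  by rewrite mulr_natl mulr2n powRD // (gt_eqF r0) implybT.
have d0 := powR_ge0 r delta.
have -> : - B + beta * t - (- B + beta * s1 / A * r `^ delta)
   = beta * (A^-1 * (A * sin t - s1 * r `^ delta) - (sin t - t)).
  by field; rewrite gt_eqF.
rewrite normrM (gtr0_norm beta0) -[leRHS]mulrA ler_pM2l //.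
apply: le_trans (ler_normB _ _) _.
rewrite normrM (gtr0_norm (_ : 0 < A^-1)) ?invr_gt0 //.
have h4 : A^-1 * `|A * sin t - s1 * r `^ delta|
    <= A^-1 * (C * r `^ delta * (beta * (k * r `^ delta))).
  rewrite ler_wpM2l ?invr_ge0 ?(ltW A0) //; apply: le_trans h1 _.
  by rewrite ler_wpM2l ?mulr_ge0 // ler_wpM2l // ltW.
move: h2 h3 h4; rewrite exprMn !expr2; move: (r `^ delta) => b.
by lra.
Unshelve. all: by end_near. Qed.

End Endpoint.

End ZeroPerturbation.

(** * Rescaling to the two model equations *)

Section LevelSets.
Variable R : realType.
Implicit Types (beta mu phis delta eta h r x : R) (g : R -> R -> R).

Definition level_zero beta g r x :=
  - (pi * beta / 2) <= x <= pi * beta / 2 /\ g r x = 0.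

(** Dividing by the order [r] of the linear part turns the zeros of [g] into
    those of a perturbation of [mu sin (x - phis)]. *)
Lemma level_zero_transversal beta mu phis p q h C g (B := pi * beta / 2)
    (T := fun r x => g r x + mu * r * sin (x - phis)) :
  0 < mu -> - B <= phis <= B -> B + phis < pi -> B - phis < pi ->
  1 < p -> p < q -> 0 <= C ->
  lipschitz_rate (- B) B p C T ->
  (\forall r \near 0^'+, `|T r phis - h * r `^ p| <= C * r `^ q) ->
  (\forall r \near 0^'+, forall x y,
     level_zero beta g r x -> level_zero beta g r y -> x = y) /\
  (forall f : R -> R, (\forall r \near 0^'+, level_zero beta g r (f r)) ->
     (fun r => f r - (phis + mu^-1 * h * r `^ (p - 1)))
       =o_ (0^'+) (fun r => r `^ (p - 1))).
Proof.
move=> mu0 phisI Bp Bm p1 pq C0 hlip hphis.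
pose e r x := r^-1 * T r x.
pose M := Num.max (B + phis) (B - phis).
have Mpi : M < pi by rewrite /M gt_max Bp.
have hM x : - B <= x <= B -> `|x - phis| <= M.
  move=> /andP[x1 x2]; rewrite /M le_max !ler_norml.
  by have [h0|h0] := leP 0 phis; apply/orP; [left|right]; lra.
have hpow r s : 0 < r -> r `^ (s - 1) = r^-1 * r `^ s.
  move=> r0; rewrite powRD ?(gt_eqF r0) ?implybT // mulrC.
  by rewrite powR_inv1 ?(ltW r0).
have elip : lipschitz_rate (- B) B (p - 1) C e.
  near=> r => x y xI yI; have r0 : 0 < r by near: r; exact: nbhs_right_gt.
  have h1 : `|T r x - T r y| <= C * r `^ p * `|x - y|.
    by move: x y xI yI; near: r.
  rewrite /e -mulrBr normrM (gtr0_norm (_ : 0 < r^-1)) ?invr_gt0 // hpow //.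
  rewrite [leRHS](_ : _ = r^-1 * (C * r `^ p * `|x - y|)); last by ring.
  by rewrite ler_wpM2l // invr_ge0 ltW.
have ephis : \forall r \near 0^'+,
    `|e r phis - h * r `^ (p - 1)| <= C * r `^ (q - 1).
  near=> r; have r0 : 0 < r by near: r; exact: nbhs_right_gt.
  have h1 : `|T r phis - h * r `^ p| <= C * r `^ q by near: r.
  rewrite /e !hpow // [h * _]mulrCA -mulrBr normrM.
  rewrite (gtr0_norm (_ : 0 < r^-1)) ?invr_gt0 // [leRHS]mulrCA.
  by rewrite ler_wpM2l // invr_ge0 ltW.
have zE : \forall r \near 0^'+, forall x, level_zero beta g r x ->
    transversal_zero mu phis (- B) B e r x.
  near=> r; have r0 : 0 < r by near: r; exact: nbhs_right_gt.
  move=> x [xI zx]; split=> //.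
  by rewrite /e /T zx add0r; field; rewrite gt_eqF.
have d0 : 0 < p - 1 by rewrite subr_gt0.
have de : p - 1 < q - 1 by rewrite ltrD2r.
split.
  have := transversal_zero_unique mu0 phisI Mpi hM d0 de C0 elip ephis.
  apply: filterS2 zE => r hr hu x y zx zy.
  by apply: hu; apply: hr.
move=> f zf.
apply: (transversal_zero_expansion mu0 phisI Mpi hM d0 de C0 elip ephis).
by apply: filterS2 zE zf => r; apply.
Unshelve. all: by end_near. Qed.

(** Here the term of order [r `^ q], [q < 1], dominates and vanishes only on the
    sides; dividing by it leaves [A cos (x / beta)] with a perturbation whose
    value at an endpoint comes from the linear part alone. *)
Lemma level_zero_endpoint beta mu phis A q C g (B := pi * beta / 2)
    (T := fun r x => g r x + mu * r * sin (x - phis)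
                     + A * r `^ q * cos (x / beta)) :
  0 < beta -> 0 < mu -> 0 < A -> 0 < sin (B + phis) -> 0 < sin (B - phis) ->
  0 < q < 1 -> 1 <= 2 * q -> 0 <= C ->
  lipschitz_rate (- B) B (2 * q) C T ->
  (\forall r \near 0^'+, T r (- B) = 0) ->
  (\forall r \near 0^'+, T r B = 0) ->
  (\forall r \near 0^'+, forall x y,
     level_zero beta g r x -> level_zero beta g r y -> x = y) /\
  (forall f : R -> R, (\forall r \near 0^'+, level_zero beta g r (f r)) ->
     exists2 K, 0 <= K & \forall r \near 0^'+,
       `|f r - (- B + beta * (mu * sin (B + phis)) / A * r `^ (1 - q))|
         <= K * r `^ (2 * (1 - q))).
Proof.
move=> beta0 mu0 A0 sp sm /andP[q0 q1] q2 C0 hlip Tm Tp.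
pose e r x := (r `^ q)^-1 * T r x - mu * r `^ (1 - q) * sin (x - phis).
have d0 : 0 < 1 - q by rewrite subr_gt0.
have hpow r : 0 < r -> r `^ (1 - q) = (r `^ q)^-1 * r.
  move=> r0; rewrite powRD ?(gt_eqF r0) ?implybT // mulrC.
  by rewrite powRr1 ?(ltW r0) // powRN.
have elip : lipschitz_rate (- B) B (1 - q) (C + mu) e.
  near=> r; have r0 : 0 < r by near: r; exact: nbhs_right_gt.
  have rq0 : 0 < (r `^ q)^-1 by rewrite invr_gt0 powR_gt0.
  have h : forall x y, - B <= x <= B -> - B <= y <= B ->
    `|T r x - T r y| <= C * r `^ (2 * q) * `|x - y| by near: r.
  have hr : r `^ (2 * q) <= r.
    rewrite -[leRHS]powRr1 ?(ltW r0) //; near: r; exact: near0_powR_antimono.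
  move=> x y xI yI.
  have -> : e r x - e r y = (r `^ q)^-1 * (T r x - T r y)
     - mu * r `^ (1 - q) * (sin (x - phis) - sin (y - phis)) by rewrite /e; ring.
  apply: le_trans (ler_normB _ _) _.
  rewrite !normrM (gtr0_norm rq0) (gtr0_norm mu0) (ger0_norm (powR_ge0 _ _)).
  rewrite !mulrDl; apply: lerD; last first.
    rewrite ler_wpM2l ?mulr_ge0 ?powR_ge0 ?(ltW mu0) //.
    apply: le_trans (sin_lipschitz _ _) _.
    by rewrite opprB addrA subrK.
  rewrite hpow //.
  have -> : C * ((r `^ q)^-1 * r) * `|x - y| = (r `^ q)^-1 * (C * r * `|x - y|).
    by ring.
  rewrite ler_wpM2l ?(ltW rq0) //; apply: le_trans (h _ _ xI yI) _.
  by rewrite ler_wpM2r // ler_wpM2l.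
have eleft : \forall r \near 0^'+, e r (- B) = mu * sin (B + phis) * r `^ (1 - q).
  near=> r; have Tm0 : T r (- B) = 0 by near: r.
  by rewrite /e Tm0 mulr0 sub0r -opprD sinN mulrN opprK mulrAC.
have eright : \forall r \near 0^'+, e r B < 0.
  near=> r; have r0 : 0 < r by near: r; exact: nbhs_right_gt.
  have Tp0 : T r B = 0 by near: r.
  by rewrite /e Tp0 mulr0 sub0r oppr_lt0 !mulr_gt0 ?powR_gt0.
have zE : \forall r \near 0^'+, forall x, level_zero beta g r x ->
    endpoint_zero beta A e r x.
  near=> r; have r0 : 0 < r by near: r; exact: nbhs_right_gt.
  move=> x [xI zx]; split=> //.
  by rewrite /e /T zx add0r hpow //; field; rewrite gt_eqF // powR_gt0.
have C1 : 0 <= C + mu by rewrite addr_ge0 // ltW.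
have s0 : 0 <= mu * sin (B + phis) by rewrite mulr_ge0 // ltW.
split.
  have := endpoint_zero_unique beta0 A0 d0 s0 C1 elip eleft eright.
  apply: filterS2 zE => r hr hu x y zx zy.
  by apply: hu; apply: hr.
move=> f zf.
apply: (endpoint_zero_expansion beta0 A0 d0 s0 C1 elip eleft eright).
by apply: filterS2 zE zf => r; apply.
Unshelve. all: by end_near. Qed.

End LevelSets.

(** * The expansion as a sine series *)

Section SectorExpansion.
Variable R : realType.
Implicit Types (beta rad mu phis k r x y C : R) (F : R * R -> R * R).

(** The intermediate value theorem, for functions about which only a Lipschitz
    bound on the interval is known. *)
Lemma lipschitz_root (f : R -> R) (a b K : R) : a <= b ->
  (forall x y, a <= x <= b -> a <= y <= b -> `|f x - f y| <= K * `|x - y|) ->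
  f b <= 0 <= f a -> exists2 x, a <= x <= b & f x = 0.
Proof.
move=> ab hl /andP[fb fa].
have cf : {within `[a, b], continuous f}.
  apply/subspace_continuousP => x; rewrite /= in_itv /= => xI.
  apply/cvgrPdist_le => eps eps0; rewrite near_withinE; near=> y.
  rewrite /= in_itv /= => yI; apply: le_trans (hl _ _ xI yI) _.
  apply: le_trans (_ : (`|K| + 1) * `|x - y| <= _).
    by rewrite ler_wpM2r // (le_trans (ler_norm K)) // lerDl.
  have K1 : 0 < `|K| + 1 by rewrite ltr_wpDl.
  rewrite mulrC -ler_pdivlMr //; near: y.
  by apply: cvgr_dist_le; [exact: cvg_id|rewrite divr_gt0].
have [|x xI fx] := @IVT R f a b 0 ab cf.
  by rewrite ge_min le_max fb fa orbT.
by exists x => //; move: xI; rewrite in_itv.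
Unshelve. all: by end_near. Qed.

Lemma complex_polar_exp (s x : R) n :
  ((s * cos x +i* (s * sin x)) ^+ n
   = s ^+ n * cos (n%:R * x) +i* (s ^+ n * sin (n%:R * x)))%C.
Proof.
elim: n => [|n IH]; first by rewrite !expr0 mul0r cos0 sin0 mulr1 mulr0.
rewrite exprS IH -[n.+1]add1n natrD mulrDl mul1r cosD sinD add1n exprS.
by apply/eqP; rewrite eq_complex /=; apply/andP; split; apply/eqP; ring.
Qed.

Lemma sector_harmonicE beta n r x : sector_harmonic beta n r x
  = (r `^ beta^-1) ^+ n * sin (n%:R * (pi / 2 + x / beta)).
Proof.
rewrite /sector_harmonic; set s := r `^ _; set y := x / beta.
have -> : ('i * (s * cos y +i* (s * sin y)) =
    s * cos (pi / 2 + y) +i* (s * sin (pi / 2 + y)))%C.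
  rewrite [pi / 2 + y]addrC cosDpihalf sinDpihalf.
  by apply/eqP; rewrite eq_complex /=; apply/andP; split; apply/eqP; ring.
by rewrite complex_polar_exp.
Qed.

(** The curve [arg F = theta] is, inside the sector, the zero set of
    [level F (cot theta)]. *)
Definition level F k r x := (F (polar r x)).1 - k * (F (polar r x)).2.

(** Since [i z^(1/beta)] has argument [pi / 2 + x / beta], the expansion is a
    sine series in this angle, which runs from [0] to [pi] between the sides. *)
Lemma level_series beta rad mu phis F a1 b1 a2 b2 k :
  expansion beta rad mu phis F a1 b1 a2 b2 ->
  exists d : nat -> R, [/\ d 1%N = a1 - k * b1, d 2%N = - (a2 - k * b2) &
    forall r x, 0 < r < rad -> - (pi * beta / 2) <= x <= pi * beta / 2 ->
      series (sine_term d (r `^ beta^-1) (pi / 2 + x / beta)) @ \oo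
        --> level F k r x + mu * r * sin (x - phis)].
Proof.
case=> -[c [c1 c2 hc]] _.
exists (fun n => (c n).1 - k * (c n).2); split.
- by rewrite c1.
- by rewrite c2 /=; ring.
move=> r x rI xI; have {hc} := hc r x rI xI.
set u := series _ => hu.
have -> : series (sine_term (fun n => (c n).1 - k * (c n).2)
    (r `^ beta^-1) (pi / 2 + x / beta)) = fun m => (u m).1 - k * (u m).2.
  apply/funext; elim=> [|m IH].
    by rewrite /u /series /= !big_geq //= mulr0 subr0.
  rewrite /u /series /= !big_nat_recr //=; move: IH; rewrite /u /series /= => ->.
  rewrite /sine_term sector_harmonicE /= /GRing.scale /=.
  by ring.
rewrite /level (_ : _ + _ = (F (polar r x) + (mu * r * sin (x - phis), 0)).1
  - k * (F (polar r x) + (mu * r * sin (x - phis), 0)).2); last first.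
  by rewrite /=; ring.
by apply: cvgB; [exact: cvg_comp hu cvg_fst|apply: cvgMr; exact: cvg_comp hu cvg_snd].
Qed.

End SectorExpansion.

(** * Lipschitz bounds for the remainders *)

Section LevelExpansion.
Variable R : realType.
Implicit Types (beta rad mu phis k r x y C : R) (F : R * R -> R * R).

Lemma lipschitz_rateW (lo hi delta C C' : R) e : C <= C' ->
  lipschitz_rate lo hi delta C e -> lipschitz_rate lo hi delta C' e.
Proof.
move=> CC'; apply: filterS => r h x y xI yI; apply: le_trans (h _ _ xI yI) _.
by rewrite ler_wpM2r // ler_wpM2r ?powR_ge0.
Qed.

Lemma eq_lipschitz_rate (lo hi delta C : R) e e' :
  (\forall r \near 0^'+, forall x, e r x = e' r x) ->
  lipschitz_rate lo hi delta C e -> lipschitz_rate lo hi delta C e'.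
Proof.
by apply: filterS2 => r ee' h x y xI yI; rewrite -!ee'; exact: h.
Qed.

Lemma sine_term_left d (s : R) n : sine_term d s 0 n = 0.
Proof. by rewrite /sine_term mulr0 sin0 mulr0. Qed.

Lemma sin_natmul_pi n : sin (n%:R * pi) = 0 :> R.
Proof.
elim: n => [|n IH]; first by rewrite mul0r sin0.
by rewrite -natr1 mulrDl mul1r sinD sinpi IH mul0r mulr0 addr0.
Qed.

Lemma sine_term_right d (s : R) n : sine_term d s pi n = 0.
Proof. by rewrite /sine_term sin_natmul_pi mulr0. Qed.

Section Remainder.
Variables (beta rad : R) (d : nat -> R) (G : R -> R -> R).
Let B := pi * beta / 2.
Let psi x := pi / 2 + x / beta.
Hypotheses (beta0 : 0 < beta) (rad0 : 0 < rad).
Hypothesis hG : forall r x, 0 < r < rad -> - B <= x <= B ->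
  series (sine_term d (r `^ beta^-1) (psi x)) @ \oo --> G r x.

Let B0 : 0 < B. Proof. by rewrite /B divr_gt0 ?mulr_gt0 ?pi_gt0. Qed.

Lemma sine_series_sides r : 0 < r < rad -> G r (- B) = 0 /\ G r B = 0.
Proof.
move=> rI.
have zero x : - B <= x <= B -> (forall s n, sine_term d s (psi x) n = 0) ->
    G r x = 0.
  move=> xI h0; have := hG rI xI.
  have -> : series (sine_term d (r `^ beta^-1) (psi x)) = fun=> 0.
    by apply/funext => m; rewrite /series /= big1.
  by move=> h; exact: (cvg_unique _ h (cvg_cst _)).
have BB : - B <= B by rewrite -subr_ge0 opprK addr_ge0 // ltW.
split; apply: zero; rewrite ?lexx ?BB // => s n.
   rewrite (_ : psi _ = 0) ?sine_term_left //.
  by rewrite /psi /B; field; rewrite gt_eqF.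
rewrite (_ : psi _ = pi) ?sine_term_right //.
by rewrite /psi /B; field; rewrite gt_eqF.
Qed.

(** The angle [x0] is the one at which the coefficients are estimated: there
    [pi / 2 + x0 / beta] has cosine [1 / 4]. *)
Lemma sine_series_remainder N : exists2 C, 0 <= C &
  lipschitz_rate (- B) B (N.+1%:R / beta) C
    (fun r x => G r x - series (sine_term d (r `^ beta^-1) (psi x)) N).
Proof.
pose a : R := acos (1 / 4).
have aI : 0 <= a <= pi by rewrite acos_ge0 ?acos_lepi //; lra.
have ca : cos a = 1 / 4 by rewrite acosK // in_itv /=; lra.
have rI : 0 < rad / 2 < rad by move: rad0; lra.
pose x0 := beta * (a - pi / 2).
have x0I : - B <= x0 <= B.
  rewrite /B /x0 [beta * _]mulrC.
  have -> : - (pi * beta / 2) = - (pi / 2) * beta by ring.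
  have -> : pi * beta / 2 = (pi / 2) * beta by ring.
  by rewrite !ler_pM2r //; lra.
have pa : psi x0 = a by rewrite /psi /x0; field; rewrite gt_eqF.
have := hG rI x0I; rewrite pa => /cvgP ha.
have s0 : 0 < (rad / 2) `^ beta^-1 by rewrite powR_gt0; move: rad0; lra.
have [K [q [K0 q0 hd]]] := sine_coefficients_growth s0 ca ha.
exists (2 * K * q ^+ N.+1 / beta).
  by rewrite divr_ge0 ?mulr_ge0 ?exprn_ge0 // ltW.
near=> r; have r0 : 0 < r by near: r; exact: nbhs_right_gt.
have rr : 0 < r < rad by rewrite r0 /=; near: r; exact: nbhs_right_lt.
have qs : q * r `^ beta^-1 <= 1 / 2.
  by near: r; apply: near0_mul_powR_le; rewrite ?invr_gt0 // ltW.
move=> x y xI yI.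
have := sine_remainder_lipschitz N K0 q0 hd (powR_ge0 _ _) qs
  (hG rr xI) (hG rr yI).
move=> /le_trans; apply.
have -> : psi x - psi y = (x - y) / beta by rewrite /psi; ring.
rewrite normrM (gtr0_norm (_ : 0 < beta^-1)) ?invr_gt0 // exprMn.
have -> : (r `^ beta^-1) ^+ N.+1 = r `^ (N.+1%:R / beta).
  by rewrite -powR_mulrn ?powR_ge0 // -powRrM mulrC.
by rewrite le_eqVlt; apply/orP; left; apply/eqP; ring.
Unshelve. all: by end_near. Qed.

End Remainder.

Lemma level_expansion beta rad mu phis F a1 b1 a2 b2 k (B := pi * beta / 2)
    (A := a1 - k * b1) (D := a2 - k * b2)
    (T := fun r x => level F k r x + mu * r * sin (x - phis)) :
  0 < beta -> 0 < rad -> expansion beta rad mu phis F a1 b1 a2 b2 ->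
  exists C, [/\ 0 <= C,
    lipschitz_rate (- B) B (1 / beta) C T,
    lipschitz_rate (- B) B (2 / beta) C
      (fun r x => T r x - A * r `^ (1 / beta) * cos (x / beta)),
    lipschitz_rate (- B) B (3 / beta) C
      (fun r x => T r x - A * r `^ (1 / beta) * cos (x / beta)
                        - D * r `^ (2 / beta) * sin (2 * x / beta)) &
    forall r, 0 < r < rad -> T r (- B) = 0 /\ T r B = 0].
Proof.
move=> beta0 rad0 /(level_series k)[d [d1 d2 hT]].
have [C0 C00 h0] := sine_series_remainder beta0 rad0 hT 0.
have [C1 C10 h1] := sine_series_remainder beta0 rad0 hT 1.
have [C2 C20 h2] := sine_series_remainder beta0 rad0 hT 2.
have t0 r x : sine_term d (r `^ beta^-1) (pi / 2 + x / beta) 0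
    = A * r `^ (1 / beta) * cos (x / beta).
  by rewrite /sine_term d1 expr1 !mul1r [pi / 2 + _]addrC sinDpihalf.
have t1 r x : sine_term d (r `^ beta^-1) (pi / 2 + x / beta) 1
    = D * r `^ (2 / beta) * sin (2 * x / beta).
  rewrite /sine_term d2 -powR_mulrn ?powR_ge0 // -powRrM [beta^-1 * 2]mulrC.
  have -> : 2 * (pi / 2 + x / beta) = 2 * x / beta + pi :> R by field; rewrite gt_eqF.
  by rewrite sinDpi /D; ring.
exists (C0 + C1 + C2); split.
- by rewrite !addr_ge0.
- apply: (@lipschitz_rateW _ _ _ C0); first by lra.
  apply: eq_lipschitz_rate h0; apply: nearW => r x.
  by rewrite /series /= big_geq // subr0.
- apply: (@lipschitz_rateW _ _ _ C1); first by lra.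
  apply: eq_lipschitz_rate h1; apply: nearW => r x.
  by rewrite /series /= big_nat1 t0.
- apply: (@lipschitz_rateW _ _ _ C2); first by lra.
  apply: eq_lipschitz_rate h2; apply: nearW => r x.
  by rewrite /series /= big_nat_recr //= big_nat1 t0 t1 opprD addrA.
- by move=> r rI; exact: (sine_series_sides beta0 hT rI).
Qed.

End LevelExpansion.

(** * Position of the zeros in each regime *)

Section LevelAsymptotics.
Variable R : realType.
Variables (beta rad mu phis k a1 b1 a2 b2 : R) (F : R * R -> R * R).
Let B := pi * beta / 2.
Let A := a1 - k * b1.
Let D := a2 - k * b2.
Let g := level F k.
Hypotheses (beta0 : 0 < beta) (rad0 : 0 < rad).
Hypothesis hF : expansion beta rad mu phis F a1 b1 a2 b2.
Hypotheses (mu0 : 0 < mu) (Bp : 0 < B + phis < pi) (Bm : 0 < B - phis < pi).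

Let phisI : - B <= phis <= B.
Proof. by move: Bp Bm; lra. Qed.

Let BI : - B <= - B <= B.
Proof. by move: Bp Bm; lra. Qed.

Let cos_side : cos (- B / beta) = 0.
Proof.
rewrite (_ : - B / beta = - (pi / 2)) ?cosN ?cos_pihalf //.
by rewrite /B; field; rewrite gt_eqF.
Qed.

Let sin_side : sin (2 * - B / beta) = 0.
Proof.
rewrite (_ : 2 * - B / beta = - pi) ?sinN ?sinpi ?oppr0 //.
by rewrite /B; field; rewrite gt_eqF.
Qed.

Let near_rad : \forall r \near (0 : R)^'+, 0 < r < rad.
Proof.
near=> r; apply/andP; split; near: r; first exact: nbhs_right_gt.
exact: nbhs_right_lt.
Unshelve. all: by end_near. Qed.

(** Both cases with a zero near [phis] follow this pattern: a remainder that is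
    Lipschitz in the angle and vanishes on a side is bounded at [phis]. *)
Let transversal_case p q h C (T := fun r x => g r x + mu * r * sin (x - phis))
    (E : R -> R -> R) :
  1 < p -> p < q -> 0 <= C -> lipschitz_rate (- B) B p C T ->
  lipschitz_rate (- B) B q C E ->
  (\forall r \near 0^'+, E r (- B) = 0) ->
  (\forall r \near 0^'+, E r phis = T r phis - h * r `^ p) ->
  (\forall r \near 0^'+, forall x y,
     level_zero beta g r x -> level_zero beta g r y -> x = y) /\
  (forall f : R -> R, (\forall r \near 0^'+, level_zero beta g r (f r)) ->
     (fun r => f r - (phis + mu^-1 * h * r `^ (p - 1)))
       =o_ (0^'+) (fun r => r `^ (p - 1))).
Proof.
move=> p1 pq C0 hT hE E0 Eh.
have pi0 := pi_gt0 R.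
have C'0 : 0 <= C * (1 + pi) by rewrite mulr_ge0 // addr_ge0 // ltW.
have CC' : C <= C * (1 + pi) by rewrite ler_peMr // lerDl ltW.
apply: (level_zero_transversal mu0 phisI _ _ p1 pq C'0).
- by case/andP: Bp.
- by case/andP: Bm.
- exact: lipschitz_rateW CC' hT.
near=> r; have <- : E r phis = T r phis - h * r `^ p by near: r.
have hl : forall x y, - B <= x <= B -> - B <= y <= B ->
    `|E r x - E r y| <= C * r `^ q * `|x - y| by near: r.
have E0r : E r (- B) = 0 by near: r.
have := hl _ _ phisI BI; rewrite E0r subr0 opprK => /le_trans; apply.
rewrite [leRHS]mulrAC ler_wpM2l ?mulr_ge0 ?powR_ge0 //.
by move: Bp; rewrite addrC => /andP[h1 h2]; rewrite gtr0_norm //; lra.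
Unshelve. all: by end_near. Qed.

(** For [beta < 1] the linear term has the lowest exponent, and the next term,
    [A r ^ (1 / beta) cos (x / beta)], determines the shift. *)
Lemma level_zero_sharp_angle : beta < 1 ->
  (\forall r \near 0^'+, forall x y,
     level_zero beta g r x -> level_zero beta g r y -> x = y) /\
  (forall f : R -> R, (\forall r \near 0^'+, level_zero beta g r (f r)) ->
     (fun r => f r - (phis + mu^-1 * (A * cos (phis / beta)) * r `^ (1 / beta - 1)))
       =o_ (0^'+) (fun r => r `^ (1 / beta - 1))).
Proof.
move=> beta1.
have [C [C0 h0 h1 _ hs]] := level_expansion k beta0 rad0 hF.
apply: (transversal_case _ _ C0 h0 h1).
- by rewrite ltr_pdivlMr // mul1r.
- by rewrite ltr_pM2r ?invr_gt0 // ltr1n.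
- apply: filterS near_rad => r /hs [Tm _].
  by rewrite Tm cos_side mulr0 subr0.
- by apply: nearW => r /=; rewrite -/g -/A; ring.
Qed.

(** For [A = 0] the linear term is again the leading one, as [2 / beta > 1]. *)
Lemma level_zero_degenerate : 1 < beta -> beta < 2 -> A = 0 ->
  (\forall r \near 0^'+, forall x y,
     level_zero beta g r x -> level_zero beta g r y -> x = y) /\
  (forall f : R -> R, (\forall r \near 0^'+, level_zero beta g r (f r)) ->
     (fun r => f r
        - (phis + mu^-1 * (D * sin (2 * phis / beta)) * r `^ (2 / beta - 1)))
       =o_ (0^'+) (fun r => r `^ (2 / beta - 1))).
Proof.
move=> beta1 beta2 A0.
have [C [C0 _ h1 h2 hs]] := level_expansion k beta0 rad0 hF.
apply: (transversal_case _ _ C0 _ h2).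
- by rewrite ltr_pdivlMr // mul1r.
- by rewrite ltr_pM2r ?invr_gt0 // ltr_nat.
- apply: eq_lipschitz_rate h1; apply: nearW => r x /=.
  by rewrite -/A A0 !mul0r subr0.
- apply: filterS near_rad => r /hs [Tm _].
  by rewrite Tm cos_side sin_side !mulr0 !subr0.
- by apply: nearW => r /=; rewrite -/g -/A -/D A0; ring.
Qed.

Let sin_Bp : 0 < sin (B + phis). Proof. exact: sin_gt0_pi. Qed.
Let sin_Bm : 0 < sin (B - phis). Proof. exact: sin_gt0_pi. Qed.

Let exponent : 1 < beta -> beta < 2 -> 0 < 1 / beta < 1 /\ 1 <= 2 * (1 / beta).
Proof.
move=> beta1 beta2; split; last first.
  by rewrite mulrA mulr1 ler_pdivlMr // mul1r ltW.
by apply/andP; split; [exact: divr_gt0|rewrite ltr_pdivrMr // mul1r].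
Qed.

Let cos_side' : cos (B / beta) = 0.
Proof. by rewrite -cosN -mulNr. Qed.

Lemma level_zero_left_side : 1 < beta -> beta < 2 -> A < 0 ->
  (\forall r \near 0^'+, forall x y,
     level_zero beta g r x -> level_zero beta g r y -> x = y) /\
  (forall f : R -> R, (\forall r \near 0^'+, level_zero beta g r (f r)) ->
     exists2 K, 0 <= K & \forall r \near 0^'+,
       `|f r - (- B - beta * (mu * A^-1) * sin (B + phis) * r `^ (1 - 1 / beta))|
         <= K * r `^ (2 * (1 - 1 / beta))).
Proof.
move=> beta1 beta2 A0; have [q1 q2] := exponent beta1 beta2.
have [C [C0 _ h1 _ hs]] := level_expansion k beta0 rad0 hF.
have A0' : 0 < - A by rewrite oppr_gt0.
have [|||hu hx] := level_zero_endpoint (g := g) beta0 mu0 A0' sin_Bp sin_Bm q1 q2 C0.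
- rewrite (_ : 2 * (1 / beta) = 2 / beta); last by rewrite mulrA mulr1.
  apply: eq_lipschitz_rate h1; apply: nearW => r x.
  by rewrite -/A -/g; ring.
- apply: filterS near_rad => r /hs [Tm _].
  by rewrite -/B cos_side mulr0 addr0.
- apply: filterS near_rad => r /hs [_ Tp].
  by rewrite -/B cos_side' mulr0 addr0.
split=> // f /hx[K K0 hK]; exists K => //; apply: filterS hK => r.
rewrite -/B.
have -> // : f r - (- B + beta * (mu * sin (B + phis)) / - A * r `^ (1 - 1 / beta))
  = f r - (- B - beta * (mu * A^-1) * sin (B + phis) * r `^ (1 - 1 / beta)).
by rewrite invrN; ring.
Qed.

(** The reflection [x -> - x], followed by a change of sign, exchanges the two
    sides, [phis] and [- phis], [A] and [- A]. *)
Lemma level_zero_right_side : 1 < beta -> beta < 2 -> 0 < A ->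
  (\forall r \near 0^'+, forall x y,
     level_zero beta g r x -> level_zero beta g r y -> x = y) /\
  (forall f : R -> R, (\forall r \near 0^'+, level_zero beta g r (f r)) ->
     exists2 K, 0 <= K & \forall r \near 0^'+,
       `|f r - (B - beta * (mu * A^-1) * sin (B - phis) * r `^ (1 - 1 / beta))|
         <= K * r `^ (2 * (1 - 1 / beta))).
Proof.
move=> beta1 beta2 A0; have [q1 q2] := exponent beta1 beta2.
have [C [C0 _ h1 _ hs]] := level_expansion k beta0 rad0 hF.
pose g' r x := - g r (- x).
have symI x : - B <= x <= B -> - B <= - x <= B.
  by rewrite lerN2 lerNl andbC.
have zE r x : level_zero beta g r x -> level_zero beta g' r (- x).
  move=> [xI zx]; split; last by rewrite /g' opprK zx oppr0.
  exact: symI.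
have sm' : 0 < sin (B + - phis) by [].
have sp' : 0 < sin (B - - phis) by rewrite opprK.
have [|||hu hx] := level_zero_endpoint (g := g') beta0 mu0 A0 sm' sp' q1 q2 C0.
- rewrite (_ : 2 * (1 / beta) = 2 / beta); last by rewrite mulrA mulr1.
  move: h1; apply: filterS => r h x y xI yI.
  have := h _ _ (symI _ yI) (symI _ xI); rewrite (_ : - y - - x = x - y); last by ring.
  apply: le_trans; rewrite le_eqVlt; apply/orP; left; apply/eqP; congr `|_|.
  rewrite !opprK !mulNr !cosN -!opprD !sinN -/A -/g /g'.
  by ring.
- apply: filterS near_rad => r /hs [_ Tp].
  rewrite -/B cos_side mulr0 addr0 /g' opprK -opprD sinN mulrN -opprD.
  by apply/eqP; rewrite oppr_eq0; apply/eqP.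
- apply: filterS near_rad => r /hs [Tm _].
  move: Tm; rewrite -/B cos_side' mulr0 addr0 /g' -opprD sinN opprK.
  by rewrite mulrN -/g => /eqP; rewrite subr_eq0 => /eqP ->; ring.
split.
  apply: filterS hu => r hu x y /zE zx /zE zy.
  by apply: oppr_inj; exact: hu.
move=> f zf; have [|K K0 hK] := hx (fun r => - f r).
  by apply: filterS zf => r; exact: zE.
exists K => //; apply: filterS hK => r; rewrite -/B -normrN.
have -> // : - (- f r - (- B + beta * (mu * sin (B + - phis)) / A
                           * r `^ (1 - 1 / beta)))
  = f r - (B - beta * (mu * A^-1) * sin (B - phis) * r `^ (1 - 1 / beta)).
by ring.
Qed.

End LevelAsymptotics.

(** * Rays, sectors and curves *)

Section PolarGeometry.
Variable R : realType.
Implicit Types (r x y beta rad theta : R).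

Lemma sin_gt0_range x : - (pi / 2) < x < 3 * pi / 2 -> 0 < sin x -> 0 < x < pi.
Proof.
move=> /andP[x1 x2] sx; have pi0 := pi_gt0 R.
apply/andP; split; rewrite ltNge; apply/negP => hx.
  have : 0 <= sin (- x) by apply: sin_ge0_pi; lra.
  by rewrite sinN; lra.
have : 0 <= sin (x - pi) by apply: sin_ge0_pi; lra.
by rewrite sinB cospi sinpi; lra.
Qed.

Lemma sector_closure_polar rad beta r x : 0 < r < rad ->
  - (pi * beta / 2) <= x <= pi * beta / 2 ->
  (sector rad beta `|` sides rad beta) (polar r x).
Proof.
move=> rI; rewrite !le_eqVlt => /andP[/orP[/eqP <-|x1] h2].
  by right; right; exists r.
move: h2 => /orP[/eqP ->|x2]; first by right; left; left; exists r.
by left; exists r, x; rewrite x1 x2.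
Qed.

Lemma cot_decreasing theta theta' : 0 < theta -> theta < theta' -> theta' < pi ->
  cot theta' < cot theta.
Proof.
move=> t0 tt tp.
have s0 : 0 < sin theta by apply: sin_gt0_pi; lra.
have s0' : 0 < sin theta' by apply: sin_gt0_pi; lra.
have s : 0 < sin (theta' - theta) by apply: sin_gt0_pi; lra.
rewrite /cot ltr_pdivrMr // mulrAC ltr_pdivlMr // -subr_gt0.
by move: s; rewrite sinB; lra.
Qed.

(** On a ray the ratio of the coordinates is the cotangent of its angle. *)
Lemma upper_rayP theta (w : R * R) : 0 < theta < pi -> 0 < w.2 ->
  (exists2 rho, 0 < rho & w = polar rho theta) <-> w.1 - cot theta * w.2 = 0.
Proof.
move=> tI w0; have s0 : 0 < sin theta := sin_gt0_pi tI.
split=> [[rho _ ->]|hw].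
  by rewrite /polar /cot /=; field; rewrite gt_eqF.
exists (w.2 / sin theta); first exact: divr_gt0.
rewrite /polar divfK ?gt_eqF //; case: w w0 hw => u v /= v0 hw.
congr pair; move/eqP: hw; rewrite subr_eq0 => /eqP ->.
by rewrite /cot; field; rewrite gt_eqF.
Qed.

Lemma homeomorphism_image (A B W : set (R * R)) (f g : R * R -> R * R) z :
  homeomorphism_on A B f g -> W `<=` B -> A z -> (g @` W) z <-> W (f z).
Proof.
move=> [[_ _ hsurj] fK _ _] WB Az; split=> [[w Ww <-]|Wz].
  have [z' Az' fz'] := hsurj _ (WB _ Ww).
  by rewrite -fz' fK ?mem_set // fz'.
by exists (f z) => //; rewrite fK // mem_set.
Qed.

End PolarGeometry.

(** * Asymptotics of the preimages of rays *)

Theorem theorem3p1 (R : realType) (beta rad sigmap sigmam : R)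
  (Z H I : set (R * R)) (F Finv : R * R -> R * R)
  (a1 b1 a2 b2 thetas : R)
  (S := sector rad beta) (L := sides rad beta)
  (mu := mu_of beta sigmap sigmam) (phis := phistar_of beta sigmap sigmam)
  (Lcurve := fun theta : R => Finv @` ray H I theta) :
  0 < beta < 2 -> beta != 1 -> 0 < rad -> 0 < sigmap -> 0 < sigmam ->
  open Z -> connected Z -> S `<=` Z -> L `<=` boundary Z ->
  open H -> connected H -> H `<=` @upper_half_plane R ->
  real_segment I -> I (0, 0) -> I `<=` boundary H ->
  harmonic_on Z (fun z => (F z).1) -> harmonic_on Z (fun z => (F z).2) ->
  {within Z `|` L, continuous F} ->
  homeomorphism_on (S `|` L) (H `|` I) F Finv ->
  F @` S = H -> F @` L = I ->
  (forall r, 0 < r < rad -> (F (polar r (pi * beta / 2))).1 = - sigmam * r) ->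
  (forall r, 0 < r < rad -> (F (polar r (- (pi * beta / 2)))).1 = sigmap * r) ->
  (forall z, L z -> (F z).2 = 0) ->
  expansion beta rad mu phis F a1 b1 a2 b2 -> 0 < b1 ->
  0 < thetas < pi -> a1 - b1 * cot thetas = 0 ->
  (forall theta, 0 <= theta <= pi ->
     exists f, polar_equation beta (Lcurve theta) f) /\
  (forall phi : R -> R -> R,
     (forall theta, 0 <= theta <= pi ->
        polar_equation beta (Lcurve theta) (phi theta)) ->
     (beta < 1 ->
        [/\ (forall theta, 0 < theta < pi ->
               let E1 := mu^-1 * (a1 - b1 * cot theta) * cos (phis / beta) in
               (fun r => phi theta r - (phis + E1 * r `^ (1 / beta - 1)))
                 =o_ (0^'+) (fun r => r `^ (1 / beta - 1))),
            \forall r \near 0^'+, phi 0 r = - (pi * beta / 2) &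
            \forall r \near 0^'+, phi pi r = pi * beta / 2]) /\
     (1 < beta ->
        let F1 theta := mu * (a1 - b1 * cot theta)^-1 in
        let E1s := mu^-1 * (a2 - b2 * cot thetas) * sin (2 * phis / beta) in
        let gamma := Num.min (1 / beta) (2 * (1 - 1 / beta)) in
        [/\ (forall theta, 0 < theta < thetas ->
               (fun r => phi theta r
                 - (- (pi * beta / 2)
                    - beta * F1 theta * sin (pi * beta / 2 + phis)
                      * r `^ (1 - 1 / beta)))
                 =O_ (0^'+) (fun r => r `^ gamma)),
            (fun r => phi thetas r - (phis + E1s * r `^ (2 / beta - 1)))
              =o_ (0^'+) (fun r => r `^ (2 / beta - 1)) &
            (forall theta, thetas < theta < pi ->
               (fun r => phi theta r
                 - (pi * beta / 2
                    - beta * F1 theta * sin (pi * beta / 2 - phis)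
                      * r `^ (1 - 1 / beta)))
                 =O_ (0^'+) (fun r => r `^ gamma))])).
Proof.
move=> /andP[beta0 beta2] beta_neq1 rad0 sigp0 sigm0 _ _ _ _ _ _ HU _ _ _ _ _ _.
move=> homeo FS FL u_minus u_plus v_L hexp b1_gt0 thetasI hthetas.
have pi0 := pi_gt0 R.
pose B := pi * beta / 2.
have B0 : 0 < B by rewrite divr_gt0 ?mulr_gt0.
have BmI : - B <= - B <= B by apply/andP; split; lra.
have BpI : - B <= B <= B by apply/andP; split; lra.
have near_rad : \forall r \near (0 : R)^'+, 0 < r < rad.
  near=> r; apply/andP; split; near: r; first exact: nbhs_right_gt.
  exact: nbhs_right_lt.
have L_plus r : 0 < r < rad -> L (polar r (- B)) by move=> rI; right; exists r.
have L_minus r : 0 < r < rad -> L (polar r B) by move=> rI; left; left; exists r.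
have F_plus r : 0 < r < rad -> F (polar r (- B)) = (sigmap * r, 0).
  move=> rI; move: (u_plus r rI) (v_L _ (L_plus _ rI)); rewrite -/B.
  by case: (F _) => u v /= -> ->.
have F_minus r : 0 < r < rad -> F (polar r B) = (- sigmam * r, 0).
  move=> rI; move: (u_minus r rI) (v_L _ (L_minus _ rI)); rewrite -/B.
  by case: (F _) => u v /= -> ->.
have level_plus k r : 0 < r < rad -> level F k r (- B) = sigmap * r.
  by move=> rI; rewrite /level F_plus //= mulr0 subr0.
have level_minus k r : 0 < r < rad -> level F k r B = - sigmam * r.
  by move=> rI; rewrite /level F_minus //= mulr0 subr0.
(* The linear part alone carries the boundary values, as all the other terms of
   the expansion vanish on the sides. *)
have [mu0 sinBp sinBm] : [/\ 0 < mu, 0 < sin (B + phis) & 0 < sin (B - phis)].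
  have [_ [_ _ _ _ hs]] := level_expansion 0 beta0 rad0 hexp.
  have rI : 0 < rad / 2 < rad by lra.
  have r0 : 0 < rad / 2 by lra.
  have [] := hs _ rI; rewrite -/B level_plus // level_minus // -opprD sinN.
  rewrite mulrN => /eqP; rewrite subr_eq0 mulrAC (inj_eq (mulIf (lt0r_neq0 r0))).
  move=> /eqP hp; rewrite mulrAC -mulrDl => /eqP.
  rewrite mulf_eq0 (gt_eqF r0) orbF addrC subr_eq0 => /eqP hm.
  have mu_ge0 : 0 <= mu by rewrite mulr_ge0 ?invr_ge0 ?normr_ge0 ?sqrtr_ge0.
  have mu_gt0 : 0 < mu.
    rewrite lt_neqAle mu_ge0 andbT; apply/eqP => mu00.
    by move: sigp0; rewrite hp -mu00 mul0r ltxx.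
  by split; rewrite // -(pmulr_rgt0 _ mu_gt0) -?hp ?hm.
have [phisl phisr] : - (pi / 2) < phis /\ phis < pi / 2.
  by rewrite /phis /phistar_of atan_gtNpi2 atan_ltpi2.
have B_pi : B < pi.
  by rewrite /B ltr_pdivrMr // ltr_pM2l.
have BpI' : 0 < B + phis < pi.
  by apply: sin_gt0_range sinBp; apply/andP; split; lra.
have BmI' : 0 < B - phis < pi.
  by apply: sin_gt0_range sinBm; apply/andP; split; lra.
have zero_exists k :
    \forall r \near 0^'+, exists x, level_zero beta (level F k) r x.
  have [C [C0 h0 _ _ _]] := level_expansion k beta0 rad0 hexp.
  near=> r; have rI : 0 < r < rad by near: r.
  have r0 : 0 < r by case/andP: rI.
  have hl : forall x y, - B <= x <= B -> - B <= y <= B ->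
    `|level F k r x + mu * r * sin (x - phis)
      - (level F k r y + mu * r * sin (y - phis))|
      <= C * r `^ (1 / beta) * `|x - y| by near: r.
  have [|x y xI yI||x xI zx] := @lipschitz_root R (level F k r) (- B) B
    (C * r `^ (1 / beta) + mu * r); last by exists x.
  - by lra.
  - rewrite (_ : level F k r x - level F k r y =
      (level F k r x + mu * r * sin (x - phis)
       - (level F k r y + mu * r * sin (y - phis)))
      - mu * r * (sin (x - phis) - sin (y - phis))); last by ring.
    apply: le_trans (ler_normB _ _) _; rewrite mulrDl; apply: lerD; first exact: hl.
    rewrite normrM (gtr0_norm (mulr_gt0 mu0 r0)) (ler_pM2l (mulr_gt0 mu0 r0)).
    by apply: le_trans (sin_lipschitz _ _) _; rewrite opprB addrA subrK.
  - rewrite level_plus // level_minus // mulNr oppr_le0.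
    by rewrite !mulr_ge0 // ltW.
have zero_unique theta : 0 < theta < pi ->
    \forall r \near 0^'+, forall x y, level_zero beta (level F (cot theta)) r x ->
      level_zero beta (level F (cot theta)) r y -> x = y.
  move=> tI; have [beta_lt1|beta_gt1|beta1] := ltgtP beta 1; last first.
  - by move: beta_neq1; rewrite beta1 eqxx.
  - have [A0|A0|A0] := ltgtP (a1 - cot theta * b1) 0.
    + by have [] := level_zero_left_side beta0 rad0 hexp mu0 BpI' BmI' beta_gt1 beta2 A0.
    + by have [] := level_zero_right_side beta0 rad0 hexp mu0 BpI' BmI' beta_gt1 beta2 A0.
    + by have [] := level_zero_degenerate beta0 rad0 hexp mu0 BpI' BmI' beta_gt1 beta2 A0.
  - by have [] := level_zero_sharp_angle (cot theta) beta0 rad0 hexp mu0 BpI' BmI' beta_lt1.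
have side_cases r x : 0 < r < rad -> - B <= x <= B ->
    [\/ x = - B, x = B | H (F (polar r x))].
  move=> rI /andP[]; rewrite le_eqVlt => /orP[/eqP <-|x1].
    by move=> _; apply: Or31.
  rewrite le_eqVlt => /orP[/eqP ->|x2]; first exact: Or32.
  apply: Or33; rewrite -FS; exists (polar r x) => //.
  by exists r, x; rewrite x1 x2.
have ray_sub theta : ray H I theta `<=` H `|` I.
  by move=> w [+ _]; case: ifP => _ ?; [left|right].
have curveE theta r x : 0 < r < rad -> - B <= x <= B ->
    Lcurve theta (polar r x) <-> ray H I theta (F (polar r x)).
  move=> rI xI; apply: homeomorphism_image homeo (@ray_sub theta) _.
  exact: sector_closure_polar.
have curve_inner theta : 0 < theta < pi -> forall r x, 0 < r < rad ->
    - B <= x <= B ->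
    Lcurve theta (polar r x) <-> level F (cot theta) r x = 0.
  move=> tI r x rI xI; rewrite curveE // /ray /= tI.
  have r0 : 0 < r by case/andP: rI.
  split=> [[Hw hray]|zx]; first exact/(upper_rayP tI (HU _ Hw)).
  have [xB|xB|Hw] := side_cases r x rI xI; last first.
  - by split=> //; exact/(upper_rayP tI (HU _ Hw)).
  - by move/eqP: zx; rewrite xB level_minus // mulf_eq0 oppr_eq0 !gt_eqF.
  - by move/eqP: zx; rewrite xB level_plus // mulf_eq0 !gt_eqF.
have curve0 r x : 0 < r < rad -> - B <= x <= B ->
    Lcurve 0 (polar r x) <-> x = - B.
  move=> rI xI; rewrite curveE // /ray /= ltxx /=.
  have r0 : 0 < r by case/andP: rI.
  split=> [[_ [rho rho0]]|->]; last first.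
    split; first by rewrite -FL; exists (polar r (- B)) => //; exact: L_plus.
    exists (sigmap * r); first exact: mulr_gt0.
    by rewrite F_plus // /polar cos0 sin0 mulr1 mulr0.
  have [//|->|Hw] := side_cases r x rI xI; rewrite /polar cos0 sin0 mulr1 mulr0 => Fw.
    move: Fw; rewrite -/(polar r B) F_minus // => -[hr].
    by have := mulr_gt0 sigm0 r0; lra.
  by have := HU _ Hw; rewrite /upper_half_plane /polar /= Fw /= ltxx.
have curvepi r x : 0 < r < rad -> - B <= x <= B ->
    Lcurve pi (polar r x) <-> x = B.
  move=> rI xI; rewrite curveE // /ray /= ltxx andbF.
  have r0 : 0 < r by case/andP: rI.
  split=> [[_ [rho rho0]]|->]; last first.
    split; first by rewrite -FL; exists (polar r B) => //; exact: L_minus.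
    exists (sigmam * r); first exact: mulr_gt0.
    by rewrite F_minus // /polar cospi sinpi mulrN1 mulr0 mulNr.
  have [->|//|Hw] := side_cases r x rI xI; rewrite /polar cospi sinpi mulrN1 mulr0 => Fw.
    move: Fw; rewrite -/(polar r (- B)) F_plus // => -[hr].
    by have := mulr_gt0 sigp0 r0; lra.
  by have := HU _ Hw; rewrite /upper_half_plane /polar /= Fw /= ltxx.
split.
  move=> theta /andP[]; rewrite le_eqVlt => /orP[/eqP <- _|t0].
    exists (fun=> - B); near=> r; have rI : 0 < r < rad by near: r.
    by split=> // x xI; exact: curve0.
  rewrite le_eqVlt => /orP[/eqP ->|tpi].
    exists (fun=> B); near=> r; have rI : 0 < r < rad by near: r.
    by split=> // x xI; exact: curvepi.
  have tI : 0 < theta < pi by rewrite t0.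
  exists (fun r => xget 0 (level_zero beta (level F (cot theta)) r)).
  near=> r; have rI : 0 < r < rad by near: r.
  have hu : forall x y, level_zero beta (level F (cot theta)) r x ->
    level_zero beta (level F (cot theta)) r y -> x = y.
    by near: r; exact: zero_unique.
  have /(xgetPex 0) hz : exists x, level_zero beta (level F (cot theta)) r x.
    by near: r; exact: zero_exists.
  split; first exact: hz.1.
  move=> x xI; rewrite curve_inner //; split=> [zx|->]; last exact: hz.2.
  by apply: hu.
move=> phi hphi.
have zero_phi theta : 0 < theta < pi ->
    \forall r \near 0^'+, level_zero beta (level F (cot theta)) r (phi theta r).
  move=> tI; have tI' : 0 <= theta <= pi.
    by case/andP: tI => t0 t1; rewrite !ltW.
  apply: filterS2 (hphi _ tI') near_rad => r [xI hr] rI.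
  by split=> //; apply/(curve_inner _ tI r _ rI xI)/hr.
split.
  move=> beta1; split.
  - move=> theta tI /=.
    have [_ /(_ _ (zero_phi _ tI))] := level_zero_sharp_angle (cot theta)
      beta0 rad0 hexp mu0 BpI' BmI' beta1.
    by rewrite -/phis mulrA [cot theta * _]mulrC.
  - have h0 : 0 <= (0 : R) <= pi by rewrite lexx ltW.
    apply: filterS2 (hphi _ h0) near_rad => r [xI hr] rI.
    by apply/esym/(hr _ BmI)/(curve0 r _ rI BmI).
  - have h0 : 0 <= (pi : R) <= pi by rewrite lexx ltW.
    apply: filterS2 (hphi _ h0) near_rad => r [xI hr] rI.
    by apply/esym/(hr _ BpI)/(curvepi r _ rI BpI).
move=> beta1 F1 E1s gamma.
have gamma_le : gamma <= 2 * (1 - 1 / beta) by rewrite ge_min lexx orbT.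
have to_O (u : R -> R) : (exists2 K, 0 <= K &
    \forall r \near 0^'+, `|u r| <= K * r `^ (2 * (1 - 1 / beta))) ->
    u =O_ (0^'+) (fun r => r `^ gamma).
  move=> [K K0 hK]; apply/eqO_exP; exists (K + 1); first by rewrite ltr_wpDl.
  apply: filterS2 hK (near0_powR_antimono gamma_le) => r h1 h2.
  rewrite (ger0_norm (powR_ge0 _ _)); apply: le_trans h1 _.
  by apply: ler_pM; rewrite ?powR_ge0 // lerDl.
have [ts0 tspi] := andP thetasI.
split.
- move=> theta /andP[t0 ts]; have tI : 0 < theta < pi by rewrite t0 (lt_trans ts).
  have A0 : a1 - cot theta * b1 < 0.
    have := cot_decreasing t0 ts tspi; rewrite -(ltr_pM2r b1_gt0).
    by move: hthetas; lra.
  have [_ /(_ _ (zero_phi _ tI))/to_O] := level_zero_left_side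
    beta0 rad0 hexp mu0 BpI' BmI' beta1 beta2 A0.
  by rewrite /F1 [b1 * _]mulrC.
- have A0 : a1 - cot thetas * b1 = 0 by rewrite mulrC.
  have [_ /(_ _ (zero_phi _ thetasI))] := level_zero_degenerate
    beta0 rad0 hexp mu0 BpI' BmI' beta1 beta2 A0.
  by rewrite /E1s mulrA [b2 * _]mulrC.
- move=> theta /andP[ts tpi]; have tI : 0 < theta < pi by rewrite (lt_trans ts0).
  have A0 : 0 < a1 - cot theta * b1.
    have := cot_decreasing ts0 ts tpi; rewrite -(ltr_pM2r b1_gt0).
    by move: hthetas; lra.
  have [_ /(_ _ (zero_phi _ tI))/to_O] := level_zero_right_side
    beta0 rad0 hexp mu0 BpI' BmI' beta1 beta2 A0.
  by rewrite /F1 [b1 * _]mulrC.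
Unshelve. all: by end_near. Qed.
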